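(* Let $\mathbb{F}$ be a field. Up to isomorphism there is a unique nilpotent symplectic alternating algebra $L$ over $\mathbb{F}$ of dimension $10$ with an isotropic centre of dimension $3$ and where $\dim L^{3}=6$ that has the further properties that $L^{3}L^{2}\neq L^{5}$ and $\dim U Z_{4}(L)=1$, where $U=\{x\in L^{3}:\ xL^{2}\leq L^{3}L^{2}\cap L^{5}\}$. This algebra is given by the presentation $$\mathcal{P}_{10}^{(3,4)}:\ (x_{1}y_{2},y_{5})=1,\ (y_{1}y_{2},y_{3})=1,\ (x_{2}y_{4},y_{5})=1.$$
   Context: A symplectic alternating algebra (SAA) over a field $\mathbb{F}$ is a finite-dimensional $\mathbb{F}$-vector space $L$ with a non-degenerate alternating bilinear form $(\ ,\ )$ and a bilinear alternating product $L\times L\to L$, $(x,y)\mapsto xy$ (so $xx=0$), such that $(xy,z)=(yz,x)$ for all $x,y,z\in L$. It follows that $(x,y,z)\mapsto (xy,z)$ is an alternating trilinear form. Isomorphisms of SAAs are linear bijections preserving the form and the product. For subspaces $A,B$, $AB$ denotes the linear span of all products $ab$ with $a\in A,b\in B$. The lower central series is $L^1=L$, $L^{k+1}=L^k L$; the upper central series is $Z_0(L)=0$, $Z_{k+1}(L)=\{x\in L: xL\leq Z_k(L)\}$, with $Z(L)=Z_1(L)$ the centre. $L$ is nilpotent if $L^{k}=0$ for some $k$. A subspace is isotropic if the form vanishes identically on it. A standard basis of a $10$-dimensional SAA is a basis $x_1,y_1,\ldots,x_5,y_5$ with $(x_i,x_j)=(y_i,y_j)=0$ and $(x_i,y_j)=\delta_{ij}$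 for all $i,j$. A presentation lists values of triples $(uv,w)$ with $u,v,w$ distinct elements of a standard basis; the convention is that all triple values of basis elements not listed (and not determined from the listed ones by the alternating property) are $0$. Such data determine the product, hence the SAA, uniquely. *)

(* Defs.v *)
From HB Require Import structures.
From mathcomp Require Import all_boot all_order all_algebra.

Set Implicit Arguments.
Unset Strict Implicit.
Unset Printing Implicit Defensive.

Import GRing.Theory.
Local Open Scope ring_scope.

Record symplAltAlg (F : fieldType) := SymplAltAlg {
  saa_space :> vectType F;
  saa_form : {biscalar saa_space};
  saa_mul : {bilinear saa_space -> saa_space -> saa_space};
  saa_form_alt : forall x, saa_form x x = 0;
  saa_form_nondeg : forall x, (forall y, saa_form x y = 0) -> x = 0;
  saa_mul_alt : forall x, saa_mul x x = 0;
  saa_form_mul : forall x y z,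
    saa_form (saa_mul x y) z = saa_form (saa_mul y z) x
}.
Arguments saa_form {F} L : rename.
Arguments saa_mul {F} L : rename.

Definition saa_isom (F : fieldType) (L M : symplAltAlg F) : Prop :=
  exists f : {linear L -> M},
    [/\ bijective f,
        forall x y, saa_form M (f x) (f y) = saa_form L x y
      & forall x y, f (saa_mul L x y) = saa_mul M (f x) (f y)].

Section Subspaces.

Variables (F : fieldType) (L : symplAltAlg F).
Implicit Types A B C : {vspace L}.

Definition saa_prod A B : {vspace L} :=
  <<[seq saa_mul L a b | a <- vbasis A, b <- vbasis B]>>%VS.

Lemma saa_prod_subP A B C :
  reflect (forall a b, a \in A -> b \in B -> saa_mul L a b \in C)
          (saa_prod A B <= C)%VS.
Proof.
apply: (iffP span_subvP) => [sABC a b Aa Bb | sABC _ /allpairsP[[a b] /= [Aa Bb ->]]];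
  last by apply: sABC; apply: vbasis_mem.
rewrite (coord_vbasis Aa) (coord_vbasis Bb) linear_sumlz.
apply: memv_suml => i _; rewrite linear_sumr; apply: memv_suml => j _.
rewrite linearZlr /=; do 2 apply: memvZ.
by apply: sABC; apply: allpairs_f; rewrite mem_nth ?size_tuple.
Qed.

(* {x in A | x B <= C} *)
Definition saa_transp A B C : {vspace L} :=
  (A :&: \bigcap_(b <- vbasis B) (linfun (applyr (saa_mul L) b) @^-1: C))%VS.

Lemma saa_transpP A B C x :
  reflect (x \in A /\ forall b, b \in B -> saa_mul L x b \in C)
          (x \in saa_transp A B C).
Proof.
have capP (s : seq L) : reflect (forall b, b \in s -> saa_mul L x b \in C)
    (x \in (\bigcap_(b <- s) (linfun (applyr (saa_mul L) b) @^-1: C))%VS).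
  elim: s => [|b s IHs]; first by rewrite big_nil memvf; left.
  rewrite big_cons memv_cap -memv_preim lfunE /=.
  apply: (iffP andP) => [[Cb /IHs Cs] c /[!inE] /predU1P[-> | /Cs] // | Cbs].
  split; first by apply: Cbs; rewrite mem_head.
  by apply/IHs => c sc; apply: Cbs; rewrite inE sc orbT.
rewrite memv_cap; apply: (iffP andP) => [[Ax /capP Cx] | [Ax Cx]].
  split=> // b Bb; rewrite (coord_vbasis Bb) linear_sumr.
  apply: memv_suml => i _; rewrite linearZr_LR; apply: memvZ.
  by apply: Cx; rewrite mem_nth ?size_tuple.
by split=> //; apply/capP => b /vbasis_mem/Cx.
Qed.

(* [saa_lcs k] is L^k for k >= 1; the term of index 0 is a dummy, also L. *)
Definition saa_lcs (k : nat) : {vspace L} :=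
  iter k.-1 (fun A => saa_prod A fullv) fullv.

Definition saa_ucs (k : nat) : {vspace L} :=
  iter k (fun Z => saa_transp fullv fullv Z) 0%VS.

Definition saa_center : {vspace L} := saa_ucs 1.

Definition saa_nilpotent : Prop := exists k, saa_lcs k = 0%VS.

Definition saa_isotropic A : Prop :=
  forall x y, x \in A -> y \in A -> saa_form L x y = 0.

(* [inl i] indexes x_i and [inr i] indexes y_i. *)
Definition standard_basis n (e : 'I_n + 'I_n -> L) : Prop :=
  [/\ basis_of fullv (codom e),
      forall i j, saa_form L (e (inl i)) (e (inl j)) = 0,
      forall i j, saa_form L (e (inr i)) (e (inr j)) = 0
    & forall i j, saa_form L (e (inl i)) (e (inr j)) = (i == j)%:R].

(* An entry (u, v, w, c) of P stands for the relation (uv, w) = c. *)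
Definition satisfies_presentation n
    (P : seq (('I_n + 'I_n) * ('I_n + 'I_n) * ('I_n + 'I_n) * F)) : Prop :=
  exists e : 'I_n + 'I_n -> L,
    [/\ standard_basis e,
        forall u v w c, (u, v, w, c) \in P ->
          saa_form L (saa_mul L (e u) (e v)) (e w) = c
      & forall u v w,
          (forall u' v' w' c, (u', v', w', c) \in P ->
             ~~ perm_eq [:: u; v; w] [:: u'; v'; w']) ->
          saa_form L (saa_mul L (e u) (e v)) (e w) = 0].

Definition saa_U : {vspace L} :=
  saa_transp (saa_lcs 3) (saa_lcs 2)
             (saa_prod (saa_lcs 3) (saa_lcs 2) :&: saa_lcs 5)%VS.

End Subspaces.

(* Indices are shifted to start from 1, for 1 <= i <= 5. *)
Definition idx_x (i : nat) : 'I_5 + 'I_5 := inl (inord i.-1).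
Definition idx_y (i : nat) : 'I_5 + 'I_5 := inr (inord i.-1).

Definition P10_3_4 (F : fieldType) :
    seq (('I_5 + 'I_5) * ('I_5 + 'I_5) * ('I_5 + 'I_5) * F) :=
  [:: (idx_x 1, idx_y 2, idx_y 5, 1);
      (idx_y 1, idx_y 2, idx_y 3, 1);
      (idx_x 2, idx_y 4, idx_y 5, 1)].

Definition P10_3_4_conditions (F : fieldType) (L : symplAltAlg F) : Prop :=
  [/\ saa_nilpotent L /\ \dim {:L} = 10%N,
      saa_isotropic (saa_center L) /\ \dim (saa_center L) = 3%N,
      \dim (saa_lcs L 3) = 6%N,
      saa_prod (saa_lcs L 3) (saa_lcs L 2) <> saa_lcs L 5
    & \dim (saa_prod (saa_U L) (saa_ucs L 4)) = 1%N].

(* Main.v *)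
Require Import Defs.
From HB Require Import structures.
From mathcomp Require Import all_boot all_order all_algebra.
From mathcomp Require Import ring zify.

Set Implicit Arguments.
Unset Strict Implicit.
Unset Printing Implicit Defensive.

Import GRing.Theory.
Local Open Scope ring_scope.

(** The trilinear form (xy, z) of a symplectic alternating algebra is
    alternating and determines the product, because the form is nondegenerate.
    So two algebras with standard bases that give the same values to all triples
    of basis vectors are isomorphic ([presentation_isom]). Conversely a list of
    triples of distinct basis vectors, no two of them permutations of each other,
    is realised by an algebra ([pres_alg_presentation]). The classification then has two halves: the
    algebra with the given presentation satisfies the conditions, and every
    algebra satisfying the conditions has the given presentation.

    For the first half, all subspaces in the conditions turn out to be spans of
    basis vectors. The product of two basis vectors is zero or a multiple of a
    basis vector, so a product of such spans is read off from the three listed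
    triples.

    For the second half, write Z, Z_2, ... for the upper central series; Z_k is
    the annihilator of L^(k+1). The dimensions give dim L^2 = 7 and
    dim Z_2 = 4. Nilpotence forces Z <= Z_2 <= L^3 <= L^2
    ([center_sub_lcs3], [ucs2_sub_lcs3]) and L^3 L^3 = 0 ([lcs3_mul_lcs3]),
    whence L^2 L^2 <= Z and L^4 <= Z_2. Choose x2 in L^4 outside Z and y2 in
    L^2 with (x2, y2) = 1. Then L^5 = x2 L and L^3 L^2 = L^3 y2 are
    two-dimensional subspaces of Z ([lcs5_perp], [prod_lcs32]). Since they
    differ, there is y1 in L^3 with y1 y2 outside L^5, and some y3 annihilated
    by x2 detects this: (y1 y2, y3) = 1. A vector x1 of L^3 with (x1, y1) = 1
    and (x1 y2, y3) = 0 has x1 y2 in the intersection of the two planes, so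
    x1 y2 = x2 y4 for some y4, and one y5 gives both (x1 y2, y5) = 1 and
    (x2 y4, y5) = 1. Thus the three listed values equal 1 without any scaling
    beyond division, which is why the result holds over every field. The
    condition on U Z_4 says exactly that x1 y3 is a multiple of x1 y2, and
    subtracting a multiple of y2 from y3 makes x1 y3 = 0 ([frame_exists]).

    The eight values still free are removed by adding multiples of x1, x2, y1
    and y2 to the chosen vectors ([kill_parameters]). Finally x3, x4, x5 are the
    central vectors y1 y2, y5 x2, x1 y2. Corrections by central vectors change
    no product, and they turn the ten vectors into a standard basis
    ([symplectic_completion]). *)

(** * Alternating products and orthogonality *)

Local Notation "''[' u , v ]" := (saa_form _ u v) : ring_scope.
Local Notation "u ** v" := (saa_mul _ u v) (at level 40) : ring_scope.

Definition saa_triple (F : fieldType) (L : symplAltAlg F) (x y z : L) : F :=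
  '[x ** y, z].
Local Notation T := saa_triple.

Section General.

Variables (F : fieldType) (L : symplAltAlg F).
Implicit Types (x y z u v w : L) (A B C U V : {vspace L}).

Lemma saa_formC x y : '[x, y] = - '[y, x].
Proof.
apply/eqP; rewrite -addr_eq0; apply/eqP.
by have := saa_form_alt (x + y); rewrite linearDl !linearDr !saa_form_alt add0r addr0.
Qed.

Lemma saa_mulC x y : x ** y = - (y ** x).
Proof.
apply/eqP; rewrite -addr_eq0; apply/eqP.
by have := saa_mul_alt (x + y); rewrite linearDl !linearDr !saa_mul_alt add0r addr0.
Qed.

Lemma tripleDl x x' y z : T (x + x') y z = T x y z + T x' y z.
Proof. by rewrite /T linearDl linearDl. Qed.
Lemma tripleDm x y y' z : T x (y + y') z = T x y z + T x y' z.
Proof. by rewrite /T linearDr linearDl. Qed.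
Lemma tripleDr x y z z' : T x y (z + z') = T x y z + T x y z'.
Proof. by rewrite /T linearDr. Qed.
Lemma tripleZl a x y z : T (a *: x) y z = a * T x y z.
Proof. by rewrite /T linearZl_LR linearZl_LR. Qed.
Lemma tripleZm a x y z : T x (a *: y) z = a * T x y z.
Proof. by rewrite /T linearZr_LR linearZl_LR. Qed.
Lemma tripleZr a x y z : T x y (a *: z) = a * T x y z.
Proof. by rewrite /T linearZr_LR. Qed.

Lemma triple_cyc x y z : T x y z = T y z x.
Proof. exact: saa_form_mul. Qed.
Lemma triple_swap x y z : T x y z = - T y x z.
Proof. by rewrite /T saa_mulC linearNl. Qed.
Lemma triple_swapr x y z : T x y z = - T x z y.
Proof. by rewrite triple_cyc triple_swap -triple_cyc. Qed.
Lemma triple_swap13 x y z : T x y z = - T z y x.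
Proof. by rewrite triple_swap -triple_cyc. Qed.
Lemma triple12 x z : T x x z = 0.
Proof. by rewrite /T saa_mul_alt linear0l. Qed.
Lemma triple23 x y : T x y y = 0.
Proof. by rewrite triple_cyc triple12. Qed.
Lemma triple13 x y : T x y x = 0.
Proof. by rewrite -triple_cyc triple12. Qed.

Lemma mul_eq0 x y : (forall z, T x y z = 0) -> x ** y = 0.
Proof. exact: saa_form_nondeg. Qed.

Definition saa_perp A : {vspace L} :=
  (\bigcap_(a <- vbasis A) lker (linfun (applyr (saa_form L) a : L -> F^o)))%VS.

Lemma saa_perpP A x : reflect (forall a, a \in A -> '[x, a] = 0) (x \in saa_perp A).
Proof.
have capP (s : seq L) : reflect (forall b, b \in s -> '[x, b] = 0)
    (x \in (\bigcap_(b <- s) lker (linfun (applyr (saa_form L) b : L -> F^o)))%VS).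
  elim: s => [|b s IHs]; first by rewrite big_nil memvf; left.
  rewrite big_cons memv_cap memv_ker lfunE /=.
  apply: (iffP andP) => [[/eqP Cb /IHs Cs] c /[!inE] /predU1P[-> | /Cs] // | Cbs].
  split; first by apply/eqP/Cbs; rewrite mem_head.
  by apply/IHs => c sc; apply: Cbs; rewrite inE sc orbT.
apply: (iffP (capP _)) => [Cx b Bb | Cx b /vbasis_mem/Cx //].
rewrite (coord_vbasis Bb) linear_sumr big1 // => i _.
by rewrite linearZr_LR /= Cx ?mulr0 // mem_nth ?size_tuple.
Qed.

Lemma notin_perp A x : x \notin saa_perp A -> exists2 a, a \in A & '[x, a] = 1.
Proof.
move=> Ax; suff [a Aa xa] : exists2 a, a \in A & '[x, a] != 0.
  by exists ('[x, a]^-1 *: a); rewrite ?memvZ // linearZr_LR /= mulVf.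
have [/allP A0|/allPn[a Aa xa]] := boolP (all (fun a => '[x, a] == 0) (vbasis A)); last first.
  by exists a => //; apply: vbasis_mem.
case/negP: Ax; apply/saa_perpP => a Aa; rewrite (coord_vbasis Aa) linear_sumr big1 // => i _.
by rewrite linearZr_LR /= (eqP (A0 _ _)) ?mulr0 // mem_nth ?size_tuple.
Qed.

Lemma saa_form_ex x : x != 0 -> exists y, '[x, y] = 1.
Proof.
move=> x0; have [|y _ xy] := @notin_perp fullv x; last by exists y.
by apply: contra x0 => /saa_perpP x0; apply/eqP/saa_form_nondeg => y; apply/x0/memvf.
Qed.

Lemma perpP2 A B : reflect (forall a b, a \in A -> b \in B -> '[a, b] = 0) (A <= saa_perp B)%VS.
Proof.
apply: (iffP subvP) => [AB a b /AB/saa_perpP ABa Bb | AB a Aa]; first exact: ABa.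
by apply/saa_perpP => b Bb; apply: AB.
Qed.

Lemma sub_perpC A B : (A <= saa_perp B)%VS = (B <= saa_perp A)%VS.
Proof. by apply/perpP2/perpP2 => AB a b Aa Bb; rewrite saa_formC AB ?oppr0. Qed.

Lemma perpS A B : (A <= B)%VS -> (saa_perp B <= saa_perp A)%VS.
Proof.
move=> /subvP AB; apply/subvP => x /saa_perpP Bx.
by apply/saa_perpP => a /AB/Bx.
Qed.

(** Each vector of a basis of B imposes one linear condition. *)
Lemma dim_perp_ge A B : (\dim A <= \dim (A :&: saa_perp B) + \dim B)%N.
Proof.
rewrite /saa_perp -[X in (_ + X)%N](size_tuple (vbasis B)).
elim: {B}(tval (vbasis B)) A => [|b s IHs] A; first by rewrite big_nil capvf addn0.
rewrite big_cons capvA /=; set f := linfun _.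
apply: leq_trans (_ : \dim (A :&: lker f) + 1 <= _)%N.
  rewrite -(limg_ker_dim f A) leq_add2l.
  by apply: leq_trans (dimvS (subvf _)) _; rewrite dimvf.
by rewrite addn1 addnS ltnS.
Qed.

(** One inequality counts conditions. For the other, an element of A orthogonal
    to a complement of the annihilator of A is orthogonal to everything. *)
Lemma dim_perp A : (\dim (saa_perp A) + \dim A = \dim {:L})%N.
Proof.
apply/eqP; rewrite eqn_leq andbC.
have := dim_perp_ge fullv A; rewrite capfv => -> /=.
have := dim_perp_ge A (saa_perp A)^C; rewrite dimv_compl.
suff -> : (A :&: saa_perp (saa_perp A)^C = 0)%VS.
  by rewrite dimv0 add0n leq_subRL // dimvS ?subvf.
apply/eqP; rewrite -subv0; apply/subvP => x; rewrite memv_cap memv0.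
case/andP=> Ax /saa_perpP Cx; apply/eqP/saa_form_nondeg => y.
have /memv_addP[y1 Ay1 [y2 Cy2 ->]] : y \in (saa_perp A + (saa_perp A)^C)%VS.
  by rewrite addv_complf memvf.
rewrite linearDr /= (Cx _ Cy2) addr0 saa_formC.
by move/saa_perpP: Ay1 => ->; rewrite ?oppr0.
Qed.

Lemma perpK A : saa_perp (saa_perp A) = A.
Proof.
apply/eqP; rewrite eq_sym eqEdim sub_perpC subvv /=.
by rewrite -(leq_add2r (\dim (saa_perp A))) dim_perp addnC dim_perp.
Qed.

Lemma mem_prod A B a b : a \in A -> b \in B -> a ** b \in saa_prod A B.
Proof. by move=> Aa Bb; have /saa_prod_subP := subvv (saa_prod A B); apply. Qed.

Lemma prodS A B A' B' : (A <= A')%VS -> (B <= B')%VS -> (saa_prod A B <= saa_prod A' B')%VS.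
Proof.
by move=> /subvP AA' /subvP BB'; apply/saa_prod_subP => a b /AA' Aa /BB' Bb; apply: mem_prod.
Qed.

Lemma prod_span_sub (s t : seq L) (C : {vspace L}) :
    (forall a b, a \in s -> b \in t -> a ** b \in C) ->
  (saa_prod <<s>> <<t>> <= C)%VS.
Proof.
move=> sC; apply/saa_prod_subP => a b sa tb.
rewrite (coord_span (X := in_tuple s) sa) linear_sumlz; apply: memv_suml => i _.
rewrite (coord_span (X := in_tuple t) tb) linear_sumr; apply: memv_suml => j _.
by rewrite linearZlr; do 2 apply: memvZ; apply: sC; apply: mem_nth.
Qed.

(** Both sides say that (x b, a) = 0 for all b and all a in A, because
    (x, a b) = (x b, a). *)
Lemma perp_prod A : saa_perp (saa_prod A fullv) = saa_transp fullv fullv (saa_perp A).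
Proof.
have form_prod x a b : '[x, a ** b] = '[x ** b, a].
  by rewrite saa_formC -/(T a b x) triple_swap13 opprK.
apply/vspaceP => x; apply/idP/idP.
  move/saa_perpP => Ax; apply/saa_transpP; split=> [|b _]; first exact: memvf.
  by apply/saa_perpP => a Aa; rewrite -form_prod Ax ?mem_prod ?memvf.
case/saa_transpP => _ Ax; rewrite memvE sub_perpC.
apply/saa_prod_subP => a b Aa Lb; apply/saa_perpP => _ /vlineP[k ->].
rewrite linearZr_LR /= saa_formC form_prod.
by move/saa_perpP: (Ax b Lb) => ->; rewrite ?oppr0 ?mulr0.
Qed.

(** The duality between the two central series: the dimensions of one give those
    of the other, and inclusions are reversed. *)
Lemma ucs_perp k : saa_ucs L k = saa_perp (saa_lcs L k.+1).
Proof.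
elim: k => [|k IHk]; last by rewrite [LHS]/= -/(saa_ucs L k) IHk -perp_prod.
apply/esym/eqP; rewrite -subv0; apply/subvP => x /saa_perpP x0.
by rewrite memv0; apply/eqP/saa_form_nondeg => y; rewrite x0 ?memvf.
Qed.

End General.

(** * A presentation determines the algebra *)

Section AlternatingTables.

Variables (I : eqType) (F : fieldType).
Implicit Types t : I -> I -> I -> F.

(** A transposition and a 3-cycle generate all permutations of the arguments. *)
Definition alternating t :=
  (forall a b c, t a b c = - t b a c) /\ (forall a b c, t a b c = t b c a).

(** Comparing two tables avoids signs: both change in the same way when the
    arguments are permuted. With t' = 0 the lemma transports zeros. *)
Lemma alternating_perm t t' u v w u' v' w' :
    alternating t -> alternating t' -> perm_eq [:: u; v; w] [:: u'; v'; w'] ->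
  t u' v' w' = t' u' v' w' -> t u v w = t' u v w.
Proof.
move=> [tS tC] [tS' tC'] /(perm_iotaP u)[Is]; rewrite -mem_permutations.
(* The six permutations in the order in which they are enumerated. *)
have -> : permutations (iota 0 (size [:: u'; v'; w'])) =
  [:: [:: 1; 0; 2]; [:: 0; 1; 2]; [:: 2; 0; 1]; [:: 0; 2; 1]; [:: 1; 2; 0]; [:: 2; 1; 0]]%N by [].
rewrite !inE => Is_perm uvw E.
have {Is_perm} : [\/ [:: u; v; w] = [:: u'; v'; w'],
     [:: u; v; w] = [:: v'; w'; u'] | [:: u; v; w] = [:: w'; u'; v']] \/
  [\/ [:: u; v; w] = [:: v'; u'; w'],
     [:: u; v; w] = [:: u'; w'; v'] | [:: u; v; w] = [:: w'; v'; u']].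
  by move: Is_perm uvw; do ?[case/orP] => /eqP -> /= ->;
    solve [left; constructor 1 => // | left; constructor 2 => // | left; constructor 3 => //
     | right; constructor 1 => // | right; constructor 2 => // | right; constructor 3 => //].
have E1 : t v' w' u' = t' v' w' u' by rewrite -tC E tC'.
have E2 : t w' u' v' = t' w' u' v' by rewrite tC E -tC'.
by case=> [] [] [-> -> ->] //; rewrite tS tS' ?E ?E1 ?E2.
Qed.

End AlternatingTables.

Section StandardBases.

Variables (F : fieldType) (n : nat).
Local Notation idx := ('I_n + 'I_n)%type.

Lemma standard_basis_ind (L : symplAltAlg F) (e : idx -> L) (P : L -> Prop) :
    standard_basis e -> P 0 -> (forall a u v, P u -> P v -> P (a *: u + v)) ->
  (forall k, P (e k)) -> forall x, P x.
Proof.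
case=> eb _ _ _ P0 PD Pe x.
rewrite (coord_basis (X := in_tuple (codom e)) eb (memvf x)).
elim/big_ind: _ => [//|u v Pu Pv|i _]; first by rewrite -[u]scale1r; apply: PD.
have /codomP[k ->] : (codom e)`_i \in codom e by rewrite mem_nth.
by rewrite -[_ *: _]addr0; apply: PD.
Qed.

Definition basis_triple (L : symplAltAlg F) (e : idx -> L) u v w : F :=
  saa_form L (saa_mul L (e u) (e v)) (e w).

Lemma basis_triple_alt (L : symplAltAlg F) (e : idx -> L) : alternating (basis_triple e).
Proof. by split=> a b c; [apply: triple_swap | apply: triple_cyc]. Qed.

(** The linear map between the bases preserves the form, and then
    (f (x y), f z) = (x y, z) = (f x f y, f z) gives the product, by nondegeneracy. *)
Lemma isom_of_basis (L M : symplAltAlg F) (e : idx -> L) (e' : idx -> M) :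
    standard_basis e -> standard_basis e' ->
  (forall u v w, basis_triple e u v w = basis_triple e' u v w) -> saa_isom L M.
Proof.
move=> se se' te; have [eb exx eyy exy] := se; have [eb' exx' eyy' exy'] := se'.
have lift (L1 L2 : symplAltAlg F) (e1 : idx -> L1) (e2 : idx -> L2) :
    standard_basis e1 -> exists f : {linear L1 -> L2}, forall k, f (e1 k) = e2 k.
  case=> eb1 _ _ _; have [f fE] := linear_of_free (codom e1) (codom e2).
  exists f => k; have /eq_in_map : map (f \o e1) (enum {: idx}) = map e2 (enum {: idx}).
    by rewrite map_comp -/(codom e1) -/(codom e2) fE ?(basis_free eb1) ?size_codom.
  by apply; rewrite mem_enum.
have [f fe] := lift _ _ _ e' se; have [g ge] := lift _ _ _ e se'.
have idE (L1 : symplAltAlg F) (e1 : idx -> L1) (h : {linear L1 -> L1}) :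
    standard_basis e1 -> (forall k, h (e1 k) = e1 k) -> forall x, h x = x.
  move=> s1 he; apply: (standard_basis_ind s1) => [|a u v hu hv|//]; first exact: linear0.
  by rewrite linearP hu hv.
have form_e k l : saa_form M (e' k) (e' l) = saa_form L (e k) (e l).
  case: k l => [i|i] [j|j]; rewrite ?exx ?exx' ?eyy ?eyy' ?exy ?exy' //.
  by rewrite saa_formC exy' saa_formC exy.
have fform x y : saa_form M (f x) (f y) = saa_form L x y.
  move: x; apply: (standard_basis_ind se) => [|a u v hu hv|k]; rewrite ?linear0 ?linear0l //.
    by rewrite linearP !linearPl hu hv.
  move: y; apply: (standard_basis_ind se) => [|a u v hu hv|l]; rewrite ?linear0 ?linear0r //.
    by rewrite linearP !linearPr hu hv.
  by rewrite !fe form_e.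
exists f; split=> //.
  exists g; [apply: (idE _ e (g \o f)) | apply: (idE _ e' (f \o g))] => //= k;
  by rewrite ?fe ?ge ?fe.
move=> x y; apply/eqP; rewrite -subr_eq0; apply/eqP/saa_form_nondeg => z'.
have {z'}[z ->] : exists z, z' = f z
  by exists (g z'); apply/esym/(idE _ e' (f \o g)) => //= k; rewrite ge fe.
rewrite linearBl /= fform; apply/eqP; rewrite subr_eq0; apply/eqP.
rewrite -!/(saa_triple _ _ _).
move: x; apply: (standard_basis_ind se) => [|a u v hu hv|k].
- by rewrite /saa_triple ?linear0 ?linear0l ?linear0l.
- by rewrite linearP !tripleDl !tripleZl hu hv.
move: y; apply: (standard_basis_ind se) => [|a u v hu hv|l].
- by rewrite /saa_triple ?linear0 ?linear0r ?linear0l.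
- by rewrite linearP !tripleDm !tripleZm hu hv.
move: z; apply: (standard_basis_ind se) => [|a u v hu hv|m].
- by rewrite /saa_triple ?linear0 ?linear0r.
- by rewrite linearP !tripleDr !tripleZr hu hv.
by rewrite !fe; apply: te.
Qed.

(** A triple of basis vectors is a permutation of a listed one or has value 0. *)
Lemma presentation_isom (L M : symplAltAlg F) P :
  satisfies_presentation (n := n) L P -> satisfies_presentation M P -> saa_isom L M.
Proof.
case=> e [se eP e0] [e' [se' eP' e0']]; apply: (isom_of_basis se se') => u v w.
have [|] := boolP (has (fun p : idx * idx * idx * F =>
   perm_eq [:: u; v; w] [:: p.1.1.1; p.1.1.2; p.1.2]) P).
  case/hasP=> [[[[u' v'] w'] c] /= Pp uvw].
  apply: alternating_perm (basis_triple_alt e) (basis_triple_alt e') uvw _.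
  by rewrite /basis_triple (eP _ _ _ _ Pp) (eP' _ _ _ _ Pp).
move/hasPn => nP; rewrite /basis_triple e0 ?e0' // => u' v' w' c /nP //.
Qed.

End StandardBases.

(** * Algebras with a given presentation *)

Section Gram.

Variables (F : fieldType) (n : nat).
Local Notation idx := ('I_n + 'I_n)%type.

(** The only basis vector that pairs nontrivially with the k-th one has index
    [flip k], and the value of that pairing is [flip_sign k]. *)
Definition flip (k : idx) : idx := match k with inl i => inr i | inr i => inl i end.
Definition flip_sign (k : idx) : F := if k is inl _ then 1 else -1.

Lemma flipK : involutive flip. Proof. by case. Qed.
Lemma flip_sign_sq k : flip_sign k * flip_sign k = 1.
Proof. by case: k => i; rewrite /= ?mulrNN mulr1. Qed.

Definition symplectic_gram (L : symplAltAlg F) (e : idx -> L) :=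
  [/\ forall i j, saa_form L (e (inl i)) (e (inl j)) = 0,
      forall i j, saa_form L (e (inr i)) (e (inr j)) = 0
    & forall i j, saa_form L (e (inl i)) (e (inr j)) = (i == j)%:R].

Lemma gram_flip (L : symplAltAlg F) (e : idx -> L) k l :
  symplectic_gram e -> saa_form L (e k) (e l) = (l == flip k)%:R * flip_sign k.
Proof.
case=> exx eyy exy; case: k l => [i|i] [j|j] /=; rewrite ?exx ?eyy ?mul0r //.
  by rewrite exy mulr1 eq_sym.
by rewrite saa_formC exy mulrN1.
Qed.

(** Independence is automatic: pairing a linear relation with the dual basis
    vectors isolates its coefficients. *)
Lemma gram_standard_basis (L : symplAltAlg F) (e : idx -> L) :
  \dim {:L} = (n + n)%N -> symplectic_gram e -> standard_basis e.
Proof.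
move=> dimL ge; have [exx eyy exy] := ge; split=> //.
rewrite basisEfree subvf size_codom card_sum card_ord dimL leqnn !andbT.
apply/(freeP (X := codom_tuple e)) => k k0 i.
have := congr1 (fun x => saa_form L x (e (flip (enum_val i)))) k0.
rewrite /= linear0l linear_sumlz (bigD1 i) //= big1 ?addr0 => [|j ij];
  rewrite linearZl_LR /= nth_codom gram_flip // (can_eq flipK) (can_eq enum_valK).
  rewrite eqxx mul1r => /(congr1 ( *%R^~ (flip_sign (enum_val i)))).
  by rewrite -mulrA flip_sign_sq mulr1 mul0r.
by rewrite eq_sym (negbTE ij) mul0r mulr0.
Qed.

End Gram.

Section PresentedAlgebra.

Variables (F : fieldType) (n : nat).
Local Notation idx := ('I_n + 'I_n)%type.
Variable P : seq (idx * idx * idx * F).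
Implicit Types (k u v w : idx).

Local Notation V := {ffun idx -> F^o}.
Implicit Types (x y z : V).

Definition pres_form x y : F :=
  \sum_(i < n) (x (inl i) * y (inr i) - x (inr i) * y (inl i)).

Definition minor u v x y : F := x u * y v - x v * y u.

(** The coordinates of the vector that represents the w-th coordinate function
    through the form. *)
Definition sharp w k : F := (w == flip k)%:R * flip_sign F k.

(** An entry (u, v, w, c) contributes to (x y, z) the determinant [det3] of the
    coordinates u, v, w of x, y, z, multiplied by c. Expanded along z this is a
    linear form, and [sharp] represents it by a vector. *)
Definition pres_mul x y : V := [ffun k =>
  \sum_(p <- P) p.2 * (minor p.1.1.1 p.1.1.2 x y * sharp p.1.2 k
    + minor p.1.1.2 p.1.2 x y * sharp p.1.1.1 k
    + minor p.1.2 p.1.1.1 x y * sharp p.1.1.2 k)].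

Definition det3 u v w x y z : F :=
  minor u v x y * z w + minor v w x y * z u + minor w u x y * z v.

Lemma crdP a x y k : (a *: x + y) k = a * x k + y k :> F.
Proof. by rewrite !ffunE. Qed.

Lemma pres_form_bilinear : bilinear_for *%R *%R pres_form.
Proof.
split=> [y|x] a x1 x2; rewrite /pres_form /= mulr_sumr -big_split;
  by apply: eq_bigr => i _; rewrite !crdP /=; ring.
Qed.

HB.instance Definition _ := bilinear_isBilinear.Build F V V F *%R *%R pres_form pres_form_bilinear.

Lemma pres_mul_bilinear : bilinear_for *:%R *:%R pres_mul.
Proof.
split=> [y|x] a x1 x2; apply/ffunP => k; rewrite /= crdP !ffunE mulr_sumr -big_split;
  by apply: eq_bigr => p _; rewrite /minor !crdP /=; ring.
Qed.

HB.instance Definition _ := bilinear_isBilinear.Build F V V V *:%R *:%R pres_mul pres_mul_bilinear.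

Lemma pres_form_alt x : pres_form x x = 0.
Proof. by rewrite /pres_form big1 // => i _; rewrite mulrC subrr. Qed.

Lemma pres_form_sharp u z : pres_form [ffun k => sharp u k] z = z u.
Proof.
rewrite /pres_form /sharp.
case: u => j; rewrite (bigD1 j) //= big1 ?addr0 => [|i ij]; rewrite !ffunE.
- by rewrite /= eqxx /=; ring.
- by rewrite /= (inj_eq (@inl_inj _ _)) eq_sym (negbTE ij) /=; ring.
- by rewrite /= eqxx /=; ring.
- by rewrite /= (inj_eq (@inr_inj _ _)) eq_sym (negbTE ij) /=; ring.
Qed.

Lemma pres_form_mul x y z :
  pres_form (pres_mul x y) z = \sum_(p <- P) p.2 * det3 p.1.1.1 p.1.1.2 p.1.2 x y z.
Proof.
pose sv w : V := [ffun k => sharp w k].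
have -> : pres_mul x y = \sum_(p <- P) p.2 *:
    (minor p.1.1.1 p.1.1.2 x y *: sv p.1.2 + minor p.1.1.2 p.1.2 x y *: sv p.1.1.1
      + minor p.1.2 p.1.1.1 x y *: sv p.1.1.2).
  by apply/ffunP => k; rewrite sum_ffunE ffunE; apply: eq_bigr => p _; rewrite !ffunE.
rewrite linear_sumlz; apply: eq_bigr => p _.
by rewrite linearZl_LR !linearDl !linearZl_LR /= !pres_form_sharp.
Qed.

Lemma pres_form_mul_cyc x y z : pres_form (pres_mul x y) z = pres_form (pres_mul y z) x.
Proof.
rewrite !pres_form_mul; apply: eq_bigr => p _; congr (_ * _).
by rewrite /det3 /minor; ring.
Qed.

Lemma pres_form_nondeg x : (forall y, pres_form x y = 0) -> x = 0.
Proof.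
move=> x0; apply/ffunP => u; rewrite ffunE -[LHS]pres_form_sharp.
have := pres_form_alt (x + [ffun k => sharp u k]).
by rewrite linearDl !linearDr /= !pres_form_alt x0 !add0r addr0.
Qed.

Lemma pres_mul_alt x : pres_mul x x = 0.
Proof.
apply/ffunP => k; rewrite !ffunE big1 // => p _; rewrite /minor.
by rewrite ![x _ * x p.1.1.1]mulrC ![x p.1.2 * _]mulrC !subrr !mul0r !addr0 mulr0.
Qed.

Definition pres_alg : symplAltAlg F :=
  SymplAltAlg (saa_space := V) pres_form_alt pres_form_nondeg pres_mul_alt pres_form_mul_cyc.

Lemma pres_alg_dim : \dim {:pres_alg} = (n + n)%N.
Proof. by rewrite dimvf /dim /= card_sum card_ord muln1. Qed.

Definition delta u : V := [ffun k => (k == u)%:R].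

Lemma det3_perm u v w a b c : ~~ perm_eq [:: a; b; c] [:: u; v; w] ->
  det3 u v w (delta a) (delta b) (delta c) = 0.
Proof.
move=> nperm.
have term u' v' w' : perm_eq [:: u'; v'; w'] [:: u; v; w] ->
    delta a u' * delta b v' * delta c w' = 0.
  move=> p; rewrite !ffunE.
  case: eqP => [ua|_]; last by rewrite !mul0r.
  case: eqP => [vb|_]; last by rewrite mulr0 !mul0r.
  case: eqP => [wc|_]; last by rewrite mulr0.
  by move: p nperm; rewrite ua vb wc => ->.
rewrite /det3 /minor !mulrBl !term ?subrr ?addr0 //;
  by apply/permP => q /=; ring.
Qed.

Lemma det3_delta u v w : uniq [:: u; v; w] -> det3 u v w (delta u) (delta v) (delta w) = 1.
Proof.
rewrite /= !inE negb_or andbT => /andP[/andP[/negbTE uv /negbTE uw] /negbTE vw].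
rewrite /det3 /minor !ffunE !eqxx /= ?uv ?uw ?vw.
by rewrite [v == u]eq_sym [w == u]eq_sym [w == v]eq_sym uv uw vw !(mul0r, mulr0, subr0, addr0, mulr1).
Qed.

Hypothesis P_uniq : uniq P.
Hypothesis P_distinct : forall p, p \in P -> uniq [:: p.1.1.1; p.1.1.2; p.1.2].
Hypothesis P_disjoint : forall p q, p \in P -> q \in P ->
  perm_eq [:: p.1.1.1; p.1.1.2; p.1.2] [:: q.1.1.1; q.1.1.2; q.1.2] -> p = q.

(** At the basis triple of an entry only the determinant of that entry is
    nonzero, and at any other triple all determinants vanish. *)
Lemma pres_alg_presentation : satisfies_presentation pres_alg P.
Proof.
exists delta; split.
- apply: gram_standard_basis; first exact: pres_alg_dim.
  split=> i j; rewrite /= /pres_form.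
  + by rewrite big1 // => k _; rewrite !ffunE /=; ring.
  + by rewrite big1 // => k _; rewrite !ffunE /=; ring.
  rewrite (bigD1 i) //= big1 => [|k ki]; rewrite !ffunE /=.
    by rewrite (inj_eq (@inr_inj _ _)) eqxx /=; ring.
  by rewrite (inj_eq (@inl_inj _ _)) (negbTE ki) /=; ring.
- move=> u v w c Pp; rewrite /= pres_form_mul (bigD1_seq _ Pp) //= big_seq_cond big1 => [|p].
    by rewrite det3_delta ?mulr1 ?addr0 //; apply: (P_distinct Pp).
  case/andP=> Pq /negP qp; rewrite det3_perm ?mulr0 //; apply/negP => uvw.
  by case: qp; apply/eqP/esym/P_disjoint.
- move=> u v w nP; rewrite /= pres_form_mul big_seq big1 // => -[[[u' v'] w'] c] /nP nperm.
  by rewrite /= det3_perm ?mulr0.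
Qed.

End PresentedAlgebra.

(** * The presented algebra satisfies the conditions *)

Local Notation idx := ('I_5 + 'I_5)%type.

(** The codes 0 to 4 stand for the x_i and 5 to 9 for the y_i, so that
    verifications over all basis vectors run by computation on numbers. *)
Definition decode (k : nat) : idx := if (k < 5)%N then inl (inord k) else inr (inord (k - 5)).
Definition code (k : idx) : nat := match k with inl i => i | inr i => (5 + i)%N end.
Definition flipn (k : nat) : nat := if (k < 5)%N then (k + 5)%N else (k - 5)%N.

Lemma codeK : cancel code decode.
Proof.
case=> i; rewrite /decode /code.
  by rewrite ltn_ord inord_val.
by rewrite ltnNge leq_addr /= addKn inord_val.
Qed.

Lemma decodeK k : (k < 10)%N -> code (decode k) = k.
Proof. by rewrite /decode; case: (ltnP k 5) => k5 k10; rewrite /= inordK; lia. Qed.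

Lemma code_lt k : (code k < 10)%N.
Proof. by case: k => i /=; have := ltn_ord i; lia. Qed.

Lemma decode_flip k : (k < 10)%N -> decode (flipn k) = flip (decode k).
Proof.
move=> k10; rewrite /flipn /decode; case: (ltnP k 5) => k5.
  by rewrite ltnNge leq_addl /= addnK.
by have -> : (k - 5 < 5)%N by lia.
Qed.

Definition listed (a b c : nat) : bool :=
  [|| perm_eq [:: a; b; c] [:: 0; 6; 9], perm_eq [:: a; b; c] [:: 5; 6; 7]
    | perm_eq [:: a; b; c] [:: 1; 8; 9]]%N.

(** The coordinate of e_a e_b on e_c is nonzero exactly when the triple of a, b
    and the dual of c is listed. So [products_in] bounds the product of two spans
    of basis vectors from above, and [products_cover] bounds it from below since
    e_a e_b has at most one nonzero coordinate. *)
Definition products_in (s1 s2 s3 : seq nat) : bool :=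
  all (fun a => all (fun b => all (fun c => (c \in s3) || ~~ listed a b (flipn c)) (iota 0 10)) s2) s1.
Definition products_cover (s1 s2 s3 : seq nat) : bool :=
  all (fun c => has (fun a => has (fun b => listed a b (flipn c)) s2) s1) s3.
Definition codes (s : seq nat) := all (fun k => k < 10)%N s.

Section Presented.

Variables (F : fieldType) (L : symplAltAlg F) (e : idx -> L).
Hypothesis se : standard_basis e.
Hypothesis e1 : forall u v w c, (u, v, w, c) \in P10_3_4 F ->
  saa_form L (saa_mul L (e u) (e v)) (e w) = c.
Hypothesis e0 : forall u v w,
  (forall u' v' w' c, (u', v', w', c) \in P10_3_4 F -> ~~ perm_eq [:: u; v; w] [:: u'; v'; w']) ->
  saa_form L (saa_mul L (e u) (e v)) (e w) = 0.

Implicit Types (a b c k : nat) (s : seq nat).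

Definition vec k : L := e (decode k).

Lemma form_vec a b : (a < 10)%N -> (b < 10)%N ->
  saa_form L (vec a) (vec b) = (b == flipn a)%:R * flip_sign F (decode a).
Proof.
move=> a10 b10; have [_ exx eyy exy] := se; rewrite gram_flip //; congr (_%:R * _).
congr nat_of_bool; rewrite -decode_flip //.
have f10 : (flipn a < 10)%N by rewrite /flipn; case: (ltnP a 5); lia.
by apply/eqP/eqP => [/(congr1 code)|->//]; rewrite !decodeK.
Qed.

Lemma P10_entries u v w (c : F) : (u, v, w, c) \in P10_3_4 F ->
  exists a b d, [/\ u = decode a, v = decode b, w = decode d, c = 1 & [:: a; b; d] \in
   [:: [:: 0; 6; 9]; [:: 5; 6; 7]; [:: 1; 8; 9]]%N].
Proof.
rewrite !inE => /or3P[] /eqP[-> -> -> ->].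
- by exists 0%N, 6%N, 9%N.
- by exists 5%N, 6%N, 7%N.
- by exists 1%N, 8%N, 9%N.
Qed.

Lemma triple_vec0 a b c : (a < 10)%N -> (b < 10)%N -> (c < 10)%N -> ~~ listed a b c ->
  saa_triple (vec a) (vec b) (vec c) = 0.
Proof.
move=> a10 b10 c10 nlisted; apply: e0 => u v w d /P10_entries[a' [b' [c' [-> -> -> _ abc']]]].
apply: contra nlisted => /(perm_map code) /=.
by move: abc'; rewrite !inE => /or3P[] /eqP[-> -> ->]; rewrite !decodeK // /listed => ->; rewrite ?orbT.
Qed.

(** A zero value would be transported to the entry, whose value is 1. *)
Lemma triple_vec_neq0 a b c : listed a b c -> saa_triple (vec a) (vec b) (vec c) != 0.
Proof.
move=> abc; apply/eqP => T0.
pose t x y z := saa_triple (vec x) (vec y) (vec z).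
have alt_t : alternating t by split=> x y z; [apply: triple_swap | apply: triple_cyc].
have alt_0 : alternating (fun _ _ _ : nat => 0 : F) by split=> // *; rewrite oppr0.
have E1 x y z : (decode x, decode y, decode z, 1) \in P10_3_4 F ->
    perm_eq [:: a; b; c] [:: x; y; z] -> False.
  move=> Pp; rewrite perm_sym => p.
  have := alternating_perm alt_t alt_0 p T0; rewrite /t /saa_triple /vec (e1 Pp).
  by move/eqP; rewrite oner_eq0.
by case/or3P: abc => abc;
  [apply: (E1 0 6 9 _ abc)%N | apply: (E1 5 6 7 _ abc)%N | apply: (E1 1 8 9 _ abc)%N];
  rewrite !inE /idx_x /idx_y /decode /= eqxx ?orbT.
Qed.

Lemma form_vec_eq0 v : (forall k, (k < 10)%N -> saa_form L v (vec k) = 0) -> v = 0.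
Proof.
move=> v0; apply: saa_form_nondeg; apply: (standard_basis_ind se).
- exact: linear0r.
- by move=> a x y x0 y0; rewrite linearPr /= x0 y0 mulr0 addr0.
by move=> k; rewrite -[k]codeK v0 ?code_lt.
Qed.

Definition span_codes s : {vspace L} := <<[seq vec k | k <- s]>>%VS.

Lemma span_codes_subP s (C : {vspace L}) :
  reflect (forall k, k \in s -> vec k \in C) (span_codes s <= C)%VS.
Proof.
apply: (iffP span_subvP) => [sC k ks|sC _ /mapP[k ks ->]]; last exact: sC.
by apply/sC/map_f.
Qed.

Lemma vec_span_codes k s : k \in s -> vec k \in span_codes s.
Proof. by move=> ks; apply/memv_span/map_f. Qed.

Lemma flipn_lt k : (k < 10)%N -> (flipn k < 10)%N.
Proof. by rewrite /flipn; case: (ltnP k 5); lia. Qed.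

Lemma flipnK k : (k < 10)%N -> flipn (flipn k) = k.
Proof.
rewrite {2}/flipn; case: (ltnP k 5) => k5 k10.
  by rewrite /flipn ltnNge leq_addl /= addnK.
by rewrite /flipn (_ : k - 5 < 5)%N ?subnK //; lia.
Qed.

Lemma mem_span_codes s v : codes s ->
  reflect (forall k, (k < 10)%N -> k \notin s -> saa_form L v (vec (flipn k)) = 0)
          (v \in span_codes s).
Proof.
move=> /allP s10; apply: (iffP idP) => [vs k k10 ks|v0].
  suff /subvP/(_ v vs)/saa_perpP : (span_codes s <= saa_perp <[vec (flipn k)]>)%VS.
    by apply; apply: memv_line.
  apply/span_codes_subP => a sa; apply/saa_perpP => _ /vlineP[z ->].
  rewrite linearZr_LR /= form_vec ?flipn_lt ?(s10 _ sa) //.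
  case: eqP => [/(congr1 flipn)|]; last by rewrite mul0r mulr0.
  by rewrite !flipnK ?(s10 _ sa) // => ka; rewrite ka sa in ks.
pose co k := saa_form L v (vec (flipn k)) * flip_sign F (decode k).
suff -> : v = \sum_(k < 10) co k *: vec k.
  apply: memv_suml => k _; case: (boolP (nat_of_ord k \in s)) => ks.
    by apply/memvZ/vec_span_codes.
  by rewrite /co v0 // mul0r scale0r mem0v.
apply/eqP; rewrite -subr_eq0; apply/eqP/form_vec_eq0 => k k10.
rewrite linearBl /= linear_sumlz (bigD1 (Ordinal (flipn_lt k10))) //= big1 ?addr0.
  rewrite linearZl_LR /= /co flipnK // form_vec ?flipn_lt // flipnK // eqxx mul1r.
  by rewrite -mulrA flip_sign_sq mulr1 subrr.
move=> i ik; rewrite linearZl_LR /= form_vec //; case: eqP => [ki|]; last by rewrite mul0r mulr0.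
by case/eqP: ik; apply: val_inj; rewrite /= ki flipnK.
Qed.

Lemma span_codes_full : span_codes (iota 0 10) = fullv.
Proof.
apply/eqP; rewrite eqEsubv subvf; apply/subvP => v _; apply/mem_span_codes => // k k10.
by rewrite mem_iota k10.
Qed.

Lemma perp_span_codes s s' : codes s -> codes s' ->
  all (fun k => (k \in s) == (flipn k \notin s')) (iota 0 10) -> saa_perp (span_codes s') = span_codes s.
Proof.
move=> s10 s10' /allP ss'; apply/vspaceP => v; apply/idP/idP => [/saa_perpP vs'|/(mem_span_codes _ s10) vs].
  apply/mem_span_codes => // k k10 ks; apply/vs'/vec_span_codes.
  by have := ss' k; rewrite mem_iota => /(_ k10)/eqP; rewrite (negbTE ks) => /esym/negbFE.
rewrite memvE sub_perpC; apply/span_codes_subP => k ks'; apply/saa_perpP => _ /vlineP[z ->].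
have k10 := allP s10' k ks'; rewrite linearZr_LR /= saa_formC.
rewrite -[k]flipnK // vs ?flipn_lt ?oppr0 ?mulr0 //.
by have := ss' (flipn k); rewrite mem_iota => /(_ (flipn_lt k10))/eqP ->; rewrite flipnK // ks'.
Qed.

Lemma presented_dim : \dim {:L} = 10%N.
Proof.
have [eb _ _ _] := se.
by rewrite (size_basis (X := codom_tuple e) eb) card_sum card_ord.
Qed.

(** The two spans annihilate each other, so their dimensions add up to 10 and
    the bounds by the numbers of generators are attained. *)
Lemma dim_span_codes s s' : codes s -> codes s' ->
  all (fun k => (k \in s) == (flipn k \notin s')) (iota 0 10) ->
  (size s + size s' = 10)%N -> \dim (span_codes s) = size s.
Proof.
move=> s10 s10' ss' sz; have := dim_perp (span_codes s'); rewrite (perp_span_codes s10 s10' ss') presented_dim.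
have := dim_span [seq vec k | k <- s]; have := dim_span [seq vec k | k <- s'].
by rewrite !size_map -!/(span_codes _); lia.
Qed.

Lemma prod_span_codes_sub s1 s2 s3 : codes s1 -> codes s2 -> codes s3 -> products_in s1 s2 s3 ->
  (saa_prod (span_codes s1) (span_codes s2) <= span_codes s3)%VS.
Proof.
move=> s10 s20 s30 /allP s123; apply: prod_span_sub => _ _ /mapP[a as1 ->] /mapP[b bs2 ->].
apply/mem_span_codes => // c c10 cs3; apply: triple_vec0;
  rewrite ?(allP s10 _ as1) ?(allP s20 _ bs2) ?flipn_lt //.
have /allP/(_ b bs2)/allP/(_ c) := s123 a as1.
by rewrite mem_iota c10 (negbTE cs3); apply.
Qed.

(** Two basis vectors occur together in at most one listed triple. *)
Lemma mul_vec a b c : (a < 10)%N -> (b < 10)%N -> (c < 10)%N -> listed a b (flipn c) ->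
  exists2 t, t != 0 & saa_mul L (vec a) (vec b) = t *: vec c.
Proof.
move=> a10 b10 c10 abc.
exists (saa_triple (vec a) (vec b) (vec (flipn c)) * flip_sign F (decode c)).
  rewrite mulf_neq0 ?triple_vec_neq0 //; apply/eqP => f0.
  by have /eqP := flip_sign_sq F (decode c); rewrite f0 mul0r eq_sym oner_eq0.
apply/eqP; rewrite -subr_eq0; apply/eqP/form_vec_eq0 => d d10.
rewrite linearBl linearZl_LR /= form_vec // -/(saa_triple _ _ _).
case: eqP => [->|/eqP dc].
  by rewrite mul1r -mulrA flip_sign_sq mulr1 subrr.
rewrite mul0r mulr0 subr0 triple_vec0 //; apply: contra dc => abd.
have /allP/(_ a)/[!mem_iota]/(_ a10)/allP/(_ b)/[!mem_iota]/(_ b10)/allP/(_ c)/[!mem_iota]/(_ c10) :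
  all (fun a => all (fun b => all (fun c => all (fun d =>
   listed a b (flipn c) ==> listed a b d ==> (d == flipn c))
   (iota 0 10)) (iota 0 10)) (iota 0 10)) (iota 0 10).
  by vm_compute.
by move/allP/(_ d); rewrite mem_iota abc abd; apply.
Qed.

Lemma prod_span_codes s1 s2 s3 : codes s1 -> codes s2 -> codes s3 ->
    products_in s1 s2 s3 && products_cover s1 s2 s3 ->
  saa_prod (span_codes s1) (span_codes s2) = span_codes s3.
Proof.
move=> s10 s20 s30 /andP[sub onto]; apply/eqP; rewrite eqEsubv prod_span_codes_sub //=.
apply/span_codes_subP => c cs3; have /hasP[a as1 /hasP[b bs2 abc]] := allP onto c cs3.
have [t t0 abE] := mul_vec (allP s10 a as1) (allP s20 b bs2) (allP s30 c cs3) abc.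
rewrite -[vec c]scale1r -(mulVf t0) -scalerA -abE; apply/memvZ/mem_prod; exact: vec_span_codes.
Qed.

Lemma presented_lcs1 : saa_lcs L 1 = fullv. Proof. by []. Qed.
Lemma saa_lcsS k : saa_lcs L k.+2 = saa_prod (saa_lcs L k.+1) fullv. Proof. by []. Qed.
Lemma presented_lcs2 : saa_lcs L 2 = span_codes (iota 0 7).
Proof. by rewrite saa_lcsS presented_lcs1 -span_codes_full; apply: prod_span_codes; vm_compute. Qed.
Lemma presented_lcs3 : saa_lcs L 3 = span_codes (iota 0 6).
Proof. by rewrite saa_lcsS presented_lcs2 -span_codes_full; apply: prod_span_codes; vm_compute. Qed.
Lemma presented_lcs4 : saa_lcs L 4 = span_codes (iota 1 4).
Proof. by rewrite saa_lcsS presented_lcs3 -span_codes_full; apply: prod_span_codes; vm_compute. Qed.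
Lemma presented_lcs5 : saa_lcs L 5 = span_codes [:: 3; 4]%N.
Proof. by rewrite saa_lcsS presented_lcs4 -span_codes_full; apply: prod_span_codes; vm_compute. Qed.
Lemma presented_lcs6 : saa_lcs L 6 = span_codes [::].
Proof. by rewrite saa_lcsS presented_lcs5 -span_codes_full; apply: prod_span_codes; vm_compute. Qed.

Lemma presented_prod32 : saa_prod (saa_lcs L 3) (saa_lcs L 2) = span_codes [:: 2; 4]%N.
Proof. by rewrite presented_lcs2 presented_lcs3; apply: prod_span_codes; vm_compute. Qed.

(** Modulo the x_i an element of L^3 is a multiple of y_1, and
    y_1 y_2 = x_3 is outside L^5. *)
Lemma presented_U : saa_U L = span_codes (iota 0 5).
Proof.
apply/vspaceP => v.
rewrite /saa_U presented_prod32 presented_lcs5 presented_lcs3 presented_lcs2.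
apply/saa_transpP/idP; last first.
  move=> vU; split.
    move: v vU; apply/subvP/span_codes_subP => k ks; apply: vec_span_codes.
    by move: ks; rewrite !mem_iota; lia.
  move=> b bL2; have vb : saa_mul L v b \in span_codes [:: 4]%N.
    suff /subvP : (saa_prod (span_codes (iota 0 5)) (span_codes (iota 0 7))
        <= span_codes [:: 4]%N)%VS by apply; apply: mem_prod.
    exact: prod_span_codes_sub.
  rewrite memv_cap; apply/andP; split; move: vb; apply/subvP/span_codes_subP => k;
    by rewrite inE => /eqP->; apply: vec_span_codes.
case=> vL3 vU; apply/mem_span_codes => // k k10; rewrite mem_iota => k5.
case: (ltnP 5 k) => [k6|k5'].
  by apply: (elimT (mem_span_codes _ _) vL3) => //; rewrite mem_iota; lia.
have -> : k = 5%N by move: k5; lia.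
(* v y_2 is paired with y_3, the dual of x_3: only the y_1-coordinate counts. *)
have /vU : vec 6 \in span_codes (iota 0 7) by apply: vec_span_codes.
rewrite memv_cap => /andP[_ /(elimT (mem_span_codes _ _))/(_ 2%N)] /= T0.
have [t t0 E67] := @mul_vec 6 7 0 isT isT isT ltac:(by vm_compute).
have := T0 isT isT isT; rewrite saa_form_mul E67 linearZl_LR /= => /eqP.
by rewrite mulf_eq0 (negbTE t0) /= saa_formC oppr_eq0 => /eqP.
Qed.

Lemma presented_conditions : P10_3_4_conditions L.
Proof.
have ZE : saa_center L = span_codes [:: 2; 3; 4]%N.
  by rewrite /saa_center ucs_perp presented_lcs2; apply: perp_span_codes.
split.
- split; last exact: presented_dim.
  by exists 6%N; rewrite presented_lcs6 /span_codes span_nil.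
- rewrite ZE; split; last by apply: (dim_span_codes (s' := iota 0 7)).
  move=> x y xZ yZ; have /saa_perpP : x \in saa_perp (span_codes [:: 2; 3; 4]%N); last exact.
  rewrite (@perp_span_codes (iota 0 7)) //; move: x xZ.
  apply/subvP/span_codes_subP => k ks; apply: vec_span_codes.
  by move: ks; rewrite !inE => /or3P[] /eqP->.
- by rewrite presented_lcs3; apply: (dim_span_codes (s' := iota 1 4)).
- rewrite presented_prod32 presented_lcs5 => E24.
  have : vec 2 \in span_codes [:: 3; 4]%N by rewrite -E24; apply: vec_span_codes.
  move/(elimT (mem_span_codes _ _))/(_ 2%N isT isT)/eqP.
  by rewrite form_vec // eqxx mul1r /decode /= => /(_ isT); rewrite oner_eq0.
have -> : saa_prod (saa_U L) (saa_ucs L 4) = span_codes [:: 4]%N.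
  rewrite presented_U ucs_perp presented_lcs5 (@perp_span_codes (iota 0 8)) //.
  by apply: prod_span_codes; vm_compute.
by apply: (dim_span_codes (s' := [:: 0; 1; 2; 3; 4; 5; 6; 7; 8]%N)).
Qed.

End Presented.

(** * Removing the free structure constants *)

Section Trilinear.

Variables (F : fieldType) (V : lmodType F) (tau : V -> V -> V -> F).
Hypothesis TDl : forall x x' y z, tau (x + x') y z = tau x y z + tau x' y z.
Hypothesis TZl : forall a x y z, tau (a *: x) y z = a * tau x y z.
Hypothesis Tcyc : forall x y z, tau x y z = tau y z x.
Hypothesis T12 : forall x z, tau x x z = 0.

Let TDm x y y' z : tau x (y + y') z = tau x y z + tau x y' z.
Proof. by rewrite 3!(Tcyc x) TDl. Qed.
Let TDr x y z z' : tau x y (z + z') = tau x y z + tau x y z'.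
Proof. by rewrite 3!(Tcyc x) 3!(Tcyc y) TDl. Qed.
Let TZm a x y z : tau x (a *: y) z = a * tau x y z.
Proof. by rewrite 2!(Tcyc x) TZl. Qed.
Let TZr a x y z : tau x y (a *: z) = a * tau x y z.
Proof. by rewrite 2!(Tcyc x) 2!(Tcyc y) TZl. Qed.
Let T23 x y : tau x y y = 0. Proof. by rewrite Tcyc T12. Qed.
Let T13 x y : tau x y x = 0. Proof. by rewrite -Tcyc T12. Qed.
Let Tswap x y z : tau x y z = - tau y x z.
Proof.
apply/eqP; rewrite -addr_eq0; apply/eqP.
by have := T12 (x + y) z; rewrite TDl !TDm !T12 add0r addr0.
Qed.

Let orders x y z c : tau x y z = c ->
  ((tau x y z = c) * (tau y z x = c) * (tau z x y = c)) *
  ((tau y x z = - c) * (tau x z y = - c) * (tau z y x = - c)).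
Proof.
move=> <-.
have sr u v w : tau u v w = - tau u w v by rewrite Tcyc Tswap -Tcyc.
have s13 u v w : tau u v w = - tau w v u by rewrite Tswap -Tcyc.
exact: ((erefl, esym (Tcyc x y z), Tcyc z x y), (Tswap y x z , sr x z y, s13 z y x)).
Qed.

Let prod0 x y : (forall z, tau x y z = 0) -> forall z,
  ((tau x y z = 0) * (tau y z x = 0) * (tau z x y = 0)) *
  ((tau y x z = 0) * (tau x z y = 0) * (tau z y x = 0)).
Proof. by move=> xy z; have /orders := xy z; rewrite !oppr0. Qed.

(** Eight values remain. Multiples of y2 added to y4 and y5 remove
    (y1 y3, y4) and (y1 y3, y5); multiples of x2 added to x1 and y1 remove
    (x1 y4, y5) and (y1 y4, y5), and y2 absorbs the effect on the form; multiples
    of y1 and x1 added to y4 and y5 remove the values (y2 yi, yj); a multiple of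
    x2 added to y3 removes (y3 y4, y5). The coefficients are written for the
    vectors as modified by the earlier steps, hence the products in them. *)
Lemma kill_parameters (x1 x2 y1 y2 y3 y4 y5 : V) :
    (forall z, tau x1 x2 z = 0) -> (forall z, tau x1 y1 z = 0) -> (forall z, tau x2 y1 z = 0) ->
    (forall z, tau x2 y2 z = 0) -> (forall z, tau x2 y3 z = 0) -> (forall z, tau x1 y3 z = 0) ->
    tau x1 y2 y5 = 1 -> tau y1 y2 y3 = 1 -> tau x2 y4 y5 = 1 ->
    tau x1 y2 y4 = 0 -> tau y1 y2 y4 = 0 -> tau y1 y2 y5 = 0 ->
  exists s t k c p q d r, let x1' := x1 + s *: x2 in let y1' := y1 + t *: x2 in
    let y2' := y2 + (- s) *: y1 + t *: x1 in let y3' := y3 + k *: x2 in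
    let y4' := y4 + c *: y2' + p *: y1 + q *: x1 in let y5' := y5 + d *: y2' + r *: y1 in
  [/\ [/\ tau x1' y2' y5' = 1, tau y1' y2' y3' = 1 & tau x2 y4' y5' = 1],
      [/\ tau x1' y2' y4' = 0, tau y1' y2' y4' = 0 & tau y1' y2' y5' = 0],
      [/\ tau x1' y4' y5' = 0, tau y1' y3' y4' = 0, tau y1' y3' y5' = 0 & tau y1' y4' y5' = 0],
      [/\ tau y2' y3' y4' = 0, tau y2' y3' y5' = 0 & tau y2' y4' y5' = 0] & tau y3' y4' y5' = 0].
Proof.
move=> m12 m11 m21 m22 m23 m13 T125 T123 T245 T124 t124 t125.
have {}m12 := prod0 m12; have {}m11 := prod0 m11; have {}m21 := prod0 m21.
have {}m22 := prod0 m22; have {}m23 := prod0 m23; have {}m13 := prod0 m13.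
have {}T125 := orders T125; have {}T123 := orders T123; have {}T245 := orders T245.
have {}T124 := orders T124; have {}t124 := orders t124; have {}t125 := orders t125.
have [[b Tb] [c Tc] [d Td] [e Te]] : [/\ exists b, tau x1 y4 y5 = b, exists c, tau y1 y3 y4 = c,
  exists d, tau y1 y3 y5 = d & exists e, tau y1 y4 y5 = e] by split; eexists.
have [[f Tf] [g Tg] [h Th]] : [/\ exists f, tau y2 y3 y4 = f, exists g, tau y2 y3 y5 = g
  & exists h, tau y2 y4 y5 = h] by split; eexists.
have {}Tb := orders Tb; have {}Tc := orders Tc; have {}Td := orders Td; have {}Te := orders Te.
have {}Tf := orders Tf; have {}Tg := orders Tg; have {}Th := orders Th.
pose linE := (TDl, TDm, TDr, TZl, TZm, TZr).
pose values := (T12, T23, T13, m12, m11, m21, m22, m23, m13, T125, T123, T245, T124, t124, t125).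
pose params := (Tb, Tc, Td, Te, Tf, Tg, Th).
pose s := - b - c; pose t := - e; pose p := - f + s * c; pose q := h - s * e + t * b.
pose r := - g + s * d.
pose y2' := y2 + (- s) *: y1 + t *: x1.
pose y4' := y4 + c *: y2' + p *: y1 + q *: x1.
pose y5' := y5 + d *: y2' + r *: y1.
(* Chosen last: (x2 y4', y5') = 1 makes this coefficient exact. *)
have [k k_def] : exists k, k = - tau y3 y4' y5' by eexists.
exists s, t, k, c, p, q, d, r; lazy zeta.
rewrite -/y2' -/y4' -/y5'.
have tau'245 : tau x2 y4' y5' = 1.
  by rewrite /y4' /y5' /y2' !(linE, values, params); ring.
split.
- split=> //; rewrite /y4' /y5' /y2' !linE !values ?params /p /q /r /s /t; ring.
- split; rewrite /y4' /y5' /y2' !linE !values ?params /p /q /r /s /t; ring.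
- split; rewrite /y4' /y5' /y2' !linE !values ?params /p /q /r /s /t; ring.
- split; rewrite /y4' /y5' /y2' !linE !values ?params /p /q /r /s /t; ring.
by rewrite TDl TZl tau'245 mulr1 k_def addrN.
Qed.

End Trilinear.

Section Frames.

Variables (F : fieldType) (L : symplAltAlg F).
Implicit Types (x y z u v w : L) (A B C U V : {vspace L}).

Variables (Z L2 : {vspace L}).

(** Vectors for seven of the ten places of the presentation, up to central
    corrections: the form is prescribed only where such corrections do not act,
    and x3, x4, x5 are left out because the product does not see them. *)
Definition frame x1 x2 y1 y2 y3 y4 y5 : Prop :=
  [/\ [/\ x1 \in L2, x2 \in L2, y1 \in L2, y2 \in L2 & forall u, x2 ** u \in Z],
      [/\ '[x1, y1] = 1, '[x2, y2] = 1
         & [/\ '[x1, x2] = 0, '[x1, y2] = 0, '[x2, y1] = 0 & '[y1, y2] = 0]],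
      [/\ x1 ** x2 = 0, x1 ** y1 = 0, x2 ** y1 = 0
         & [/\ x2 ** y2 = 0, x2 ** y3 = 0 & x1 ** y3 = 0]],
      [/\ T x1 y2 y5 = 1, T y1 y2 y3 = 1 & T x2 y4 y5 = 1] &
      [/\ T x1 y2 y4 = 0, T y1 y2 y4 = 0 & T y1 y2 y5 = 0]].

Definition normal_frame x1 x2 y1 y2 y3 y4 y5 : Prop :=
  [/\ frame x1 x2 y1 y2 y3 y4 y5, T x1 y4 y5 = 0,
      [/\ T y1 y3 y4 = 0, T y1 y3 y5 = 0 & T y1 y4 y5 = 0],
      [/\ T y2 y3 y4 = 0, T y2 y3 y5 = 0 & T y2 y4 y5 = 0] & T y3 y4 y5 = 0].

Definition formD := (@linearDl _ _ _ _ _ _ (saa_form L), @linearDr _ _ _ _ _ _ (saa_form L)).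
Definition formZ := (@linearZl_LR _ _ _ _ _ _ (saa_form L), @linearZr_LR _ _ _ _ _ _ (saa_form L)).
Definition mulD := (@linearDl _ _ _ _ _ _ (saa_mul L), @linearDr _ _ _ _ _ _ (saa_mul L)).
Definition mulZ := (@linearZl_LR _ _ _ _ _ _ (saa_mul L), @linearZr_LR _ _ _ _ _ _ (saa_mul L)).

Lemma mulC0 x y : x ** y = 0 -> y ** x = 0.
Proof. by move=> xy; rewrite saa_mulC xy oppr0. Qed.

Lemma formC_eq x y c : '[x, y] = c -> '[y, x] = - c.
Proof. by move=> xy; rewrite saa_formC xy. Qed.

(** The modification of x1, y1 and y2 by [kill_parameters] is a symplectic shear
    of the span of x1, x2, y1, y2. *)
Lemma normalize_frame x1 x2 y1 y2 y3 y4 y5 : frame x1 x2 y1 y2 y3 y4 y5 ->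
  exists x1' y1' y2' y3' y4' y5', normal_frame x1' x2 y1' y2' y3' y4' y5'.
Proof.
case=> [[x1L x2L y1L y2L x2Z] [f11 f22 [fx12 f12 f21 fy12]] [m12 m11 m21 [m22 m23 m13]]
  [T125 T123 T245] [T124 t124 t125]].
have prodT x y : x ** y = 0 -> forall z, T x y z = 0 by move=> xy z; rewrite /T xy linear0l.
have [s [t [k [c [p [q [d [r [[T1 T2 T3] [T4 T5 T6] [T7 T8 T9 T10] T11 T12]]]]]]]]] :=
  kill_parameters (@tripleDl F L) (@tripleZl F L) (@triple_cyc F L) (@triple12 F L)
   (prodT _ _ m12) (prodT _ _ m11) (prodT _ _ m21) (prodT _ _ m22) (prodT _ _ m23) (prodT _ _ m13)
   T125 T123 T245 T124 t124 t125.
do 6!eexists; split; [| exact: T7 | by split; [exact: T8 | exact: T9 | exact: T10] | exact: T11 | exact: T12].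
split; [| | | by split; [exact: T1|exact: T2|exact: T3] | by split; [exact: T4|exact: T5|exact: T6]].
- by split=> //; rewrite !memvD ?memvZ.
- rewrite !formD !formZ /= !saa_form_alt f11 f22 fx12 f12 f21 fy12.
  rewrite ?(formC_eq f11, formC_eq f22, formC_eq fx12, formC_eq f12, formC_eq f21).
  by split; [ring | ring | split; ring].
- rewrite !mulD !mulZ !saa_mul_alt m12 m11 m21 m22 m23 m13.
  rewrite (mulC0 m12) !scaler0 !addr0.
  by do !split.
Qed.

End Frames.

(** * From a normal frame to a standard basis *)

Lemma listed_perm a b c a' b' c' :
  perm_eq [:: a; b; c] [:: a'; b'; c'] -> listed a b c = listed a' b' c'.
Proof. by move=> /permPl abc; rewrite /listed !abc. Qed.

(** Only increasing triples need a check. Vanishing on repeated arguments is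
    assumed separately: antisymmetry does not imply it in characteristic 2. *)
Lemma alternating_sorted0 (F : fieldType) (t : nat -> nat -> nat -> F) n :
    alternating t -> (forall a c, t a a c = 0) ->
    (forall a b c, (a < b < c)%N -> (c < n)%N -> ~~ listed a b c -> t a b c = 0) ->
  forall a b c, (a < n)%N -> (b < n)%N -> (c < n)%N -> ~~ listed a b c -> t a b c = 0.
Proof.
move=> alt_t t0 t_sorted a b c an bn cn nlisted.
have [tS tC] := alt_t.
have [] := boolP (uniq [:: a; b; c]); last first.
  rewrite /= !inE andbT negb_and !negbK -orbA => /or3P[] /eqP ->; first exact: t0.
    by rewrite tC tS tC tC t0 oppr0.
  by rewrite tC t0.
move=> abcU; have := sort_sorted leq_total [:: a; b; c].
have abc_perm : perm_eq [:: a; b; c] (sort leq [:: a; b; c]) by rewrite perm_sym perm_sort.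
have := perm_size abc_perm; have := perm_uniq abc_perm; rewrite abcU.
case: (sort _ _) abc_perm => [//|a' [//|b' [//|c' [|//]]]] abc_perm U' _ S'.
have : sorted ltn [:: a'; b'; c'] by rewrite ltn_sorted_uniq_leq -U' S'.
rewrite /= andbT => abc'.
have alt0 : alternating (fun _ _ _ : nat => 0 : F) by split=> // *; rewrite oppr0.
apply: (alternating_perm alt_t alt0 abc_perm); apply: t_sorted => //.
  have : c' \in [:: a; b; c] by rewrite (perm_mem abc_perm) !inE eqxx !orbT.
  by rewrite !inE => /or3P[] /eqP ->.
by rewrite -(listed_perm abc_perm).
Qed.

Section FromFrame.

Variables (F : fieldType) (L : symplAltAlg F).
Implicit Types (x y z u v w : L) (A B C U V : {vspace L}).

Variables (Z L2 : {vspace L}).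
Hypothesis dimL : \dim {:L} = 10%N.
Hypothesis Zmul : forall z u, z \in Z -> z ** u = 0.
Hypothesis ZL2 : forall z u, z \in Z -> u \in L2 -> '[z, u] = 0.
Hypothesis sZL2 : (Z <= L2)%VS.
Hypothesis L2L2 : forall u v, u \in L2 -> v \in L2 -> u ** v \in Z.

Lemma triple_modZ u u' v v' w w' : u - u' \in Z -> v - v' \in Z -> w - w' \in Z ->
  T u v w = T u' v' w'.
Proof.
move=> uZ vZ wZ.
have shift a a' b c : a - a' \in Z -> T a b c = T a' b c.
  move=> aZ; rewrite -{1}(subrK a' a) tripleDl -[RHS]add0r; congr (_ + _).
  by rewrite /T Zmul // linear0l.
rewrite (shift _ _ _ _ uZ) triple_cyc (shift _ _ _ _ vZ) triple_cyc (shift _ _ _ _ wZ).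
by rewrite triple_cyc.
Qed.

(** The zeros are representatives of x_3, x_4, x_5 modulo Z. *)
Definition frame_vec x1 x2 y1 y2 y3 y4 y5 : nat -> L :=
  nth 0 [:: x1; x2; 0; 0; 0; y1; y2; y3; y4; y5].

(** As x3, x4, x5 are dual to y3, y4, y5, adding combinations of them first
    makes x1, x2, y1, y2 orthogonal to y3, y4, y5, and then makes y3, y4, y5
    orthogonal to one another. *)
Lemma symplectic_completion x1 x2 x3 x4 x5 y1 y2 y3 y4 y5 :
    [/\ x1 \in L2, x2 \in L2, y1 \in L2 & y2 \in L2] ->
    [/\ x3 \in Z, x4 \in Z & x5 \in Z] ->
    [/\ '[x1, y1] = 1, '[x2, y2] = 1
       & [/\ '[x1, x2] = 0, '[x1, y2] = 0, '[x2, y1] = 0 & '[y1, y2] = 0]] ->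
    [/\ '[x3, y3] = 1, '[x3, y4] = 0 & '[x3, y5] = 0] ->
    [/\ '[x4, y3] = 0, '[x4, y4] = 1 & '[x4, y5] = 0] ->
    [/\ '[x5, y3] = 0, '[x5, y4] = 0 & '[x5, y5] = 1] ->
  exists2 e : nat -> L, forall k, e k - frame_vec x1 x2 y1 y2 y3 y4 y5 k \in Z
    & symplectic_gram (e \o code).
Proof.
move=> [x1L x2L y1L y2L] [x3Z x4Z x5Z] [f11 f22 [fx12 f12 f21 fy12]].
move=> [x33 x34 x35] [x43 x44 x45] [x53 x54 x55]; set base := frame_vec _ _ _ _ _ _ _.
pose pi v := - ('[v, y3] *: x3 + '[v, y4] *: x4 + '[v, y5] *: x5).
have piZ v : pi v \in Z by rewrite memvN !memvD // memvZ.
have pi_orth v : ('[v + pi v, y3] = 0) * ('[v + pi v, y4] = 0) * ('[v + pi v, y5] = 0).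
  rewrite /pi !(linearDl, linearNl, linearZl_LR) /= x33 x34 x35 x43 x44 x45 x53 x54 x55.
  by do !split; ring.
pose z4 := - '[y4, y3] *: x3; pose z5 := - '[y5, y3] *: x3 - '[y5, y4] *: x4.
pose e := nth 0 [:: x1 + pi x1; x2 + pi x2; x3; x4; x5; y1 + pi y1; y2 + pi y2; y3; y4 + z4; y5 + z5].
have eZ k : e k - base k \in Z.
  have shiftZ v z : z \in Z -> v + z - v \in Z by rewrite addrAC subrr add0r.
  do 10?[case: k => [|k]]; rewrite /e /base /frame_vec /= ?subr0 ?subrr ?mem0v ?shiftZ //.
    by rewrite memvZ.
  by rewrite memvB ?memvZ.
have form_Z u v v' : u \in L2 -> v - v' \in Z -> '[u, v] = '[u, v'].
  move=> uL vZ; rewrite -{1}(subrK v' v) linearDr /= saa_formC (ZL2 vZ uL).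
  by rewrite oppr0 add0r.
have base_L2 a : (a < 7)%N -> base a \in L2.
  by do 7?[case: a => [|a] //]; rewrite /base /frame_vec /= mem0v.
have e_L2 a : (a < 7)%N -> e a \in L2.
  move=> a7; rewrite -(subrK (base a) (e a)).
  by apply: memvD; [apply: (subvP sZL2); apply: eZ | apply: base_L2].
have form_e a b : (a < 7)%N -> (b < 7)%N -> '[e a, e b] = '[base a, base b].
  move=> a7 b7; rewrite (form_Z _ _ (base b)) ?e_L2 //.
  by rewrite saa_formC (form_Z _ _ (base a)) ?base_L2 // -saa_formC.
have form_y a k : (a < 7)%N -> '[e a, e k] = '[e a, base k].
  by move=> a7; apply: form_Z; rewrite ?e_L2.
have [y34 y35 y45] : [/\ '[y3, y4 + z4] = 0, '[y3, y5 + z5] = 0 & '[y4 + z4, y5 + z5] = 0].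
  have [x3L x4L] : x3 \in L2 /\ x4 \in L2 by rewrite !(subvP sZL2).
  have [x3x3 x3x4] : '[x3, x3] = 0 /\ '[x3, x4] = 0 by rewrite !ZL2.
  rewrite /z4 /z5 -!scaleNr !(linearDl, linearZl_LR, linearDr, linearZr_LR) /=.
  rewrite (saa_formC y3 x3) (saa_formC y3 x4) (saa_formC y4 x3) (saa_formC y4 x4).
  rewrite (saa_formC y3 y4) (saa_formC y3 y5) (saa_formC y4 y5).
  by rewrite x33 x34 x35 x43 x44 x3x3 x3x4; split; ring.
have form_xy a k : a \in [:: 0; 1; 5; 6]%N -> (1 < k < 5)%N -> '[e a, e (5 + k)] = 0.
  rewrite !inE => a0156; rewrite form_y; last by case/or4P: a0156 => /eqP->.
  by case: k => [|[|[|[|[|k]]]]] //; case/or4P: a0156 => /eqP-> _;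
    rewrite /e /base /frame_vec /= pi_orth.
exists e => //; split.
- move=> [[|[|[|[|[|//]]]]] ?] [[|[|[|[|[|//]]]]] ?]; rewrite /= form_e // /base /frame_vec /=;
    rewrite ?linear0l ?linear0r ?saa_form_alt //.
  by rewrite saa_formC fx12 oppr0.
- have form_yy (i j : 'I_5) : (i <= j)%N -> '[e (5 + i)%N, e (5 + j)%N] = 0.
    case: j i => [[|[|[|[|[|//]]]]] ?] [[|[|[|[|[|//]]]]] ?] //= _; rewrite ?saa_form_alt //;
      by [rewrite form_e | exact: form_xy | exact: y34 | exact: y35 | exact: y45].
  move=> i j; case: (leqP i j) => [ij|/ltnW ji]; first exact: form_yy.
  by apply/eqP; rewrite saa_formC oppr_eq0; apply/eqP; exact: form_yy.
move=> [[|[|[|[|[|//]]]]] ?] [[|[|[|[|[|//]]]]] ?]; rewrite -[LHS]/('[e _, e _]) /=;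
  by [rewrite form_e // ?linear0l | exact: form_xy | rewrite form_y].
Qed.

Lemma normal_frame_triple0 x1 x2 y1 y2 y3 y4 y5 (base := frame_vec x1 x2 y1 y2 y3 y4 y5) :
    normal_frame Z L2 x1 x2 y1 y2 y3 y4 y5 ->
  forall a b c, (a < b < c)%N -> (c < 10)%N -> ~~ listed a b c ->
  T (base a) (base b) (base c) = 0.
Proof.
case=> [[_ _ [m12 m11 m21 [m22 m23 m13]] _ [T124 t124 t125]]] Tb [Tc Td Te] [Tf Tg Th] Tk.
have T123 : T x1 y2 y3 = 0 by rewrite triple_swapr /T m13 linear0l oppr0.
have zeroT : (forall y z, T 0 y z = 0) * (forall x z, T x 0 z = 0) * (forall x y, T x y 0 = 0).
  by split=> [|x y]; [split=> y z|]; rewrite /T ?linear0l ?linear0r ?linear0l.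
have prodT x y : x ** y = 0 -> forall z, T x y z = 0 by move=> xy z; rewrite /T xy linear0l.
pose values := (prodT _ _ m12, prodT _ _ m11, prodT _ _ m21, prodT _ _ m22, prodT _ _ m23,
  prodT _ _ m13, T123, (T124, t124, t125), Tb, (Tc, Td, Te), (Tf, Tg, Th), Tk).
(* Every increasing triple is listed, has a central member, has two members with
   product zero, or is one of twelve triples whose value is known to be 0. *)
have cover : (all (fun a => all (fun b => all (fun c => (a < b < c) ==> [|| listed a b c,
    has (mem [:: 2; 3; 4]) [:: a; b; c],
    (a, b) \in [:: (0, 1); (0, 5); (1, 5); (1, 6); (1, 7); (0, 7)] |
    (a, b, c) \in [:: (0, 6, 7); (0, 6, 8); (0, 8, 9); (5, 6, 8); (5, 6, 9); (5, 7, 8);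
      (5, 7, 9); (5, 8, 9); (6, 7, 8); (6, 7, 9); (6, 8, 9); (7, 8, 9)]])
  (iota 0 10)) (iota 0 10)) (iota 0 10))%N by vm_compute.
move=> a b c abc c10 nlisted; have b10 : (b < 10)%N by apply: ltn_trans c10; case/andP: abc.
have a10 : (a < 10)%N by apply: ltn_trans b10; case/andP: abc.
have /allP/(_ a)/[!mem_iota]/(_ a10)/allP/(_ b)/[!mem_iota]/(_ b10) := cover.
move=> /allP/(_ c)/[!mem_iota]/(_ c10)/implyP/(_ abc); rewrite (negbTE nlisted) {cover} /=.
case/or3P.
- by case/or4P=> //; rewrite !inE => /or3P[] /eqP->; rewrite /base /frame_vec /= zeroT.
- rewrite !inE => abE; move: abE.
  by do 5?[case/orP]; case/eqP=> -> ->; rewrite /base /frame_vec /= values.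
rewrite !inE => abcE; move: abcE.
by do 11?[case/orP]; case/eqP=> -> -> ->; rewrite /base /frame_vec /= values.
Qed.

Lemma normal_frame_presentation x1 x2 y1 y2 y3 y4 y5 :
  normal_frame Z L2 x1 x2 y1 y2 y3 y4 y5 -> satisfies_presentation L (P10_3_4 F).
Proof.
move=> nf; have T0 := normal_frame_triple0 nf.
have [[xyL2 forms [_ _ _ [_ m23 _]] [T125 T123 T245] [T124 t124 t125]] _ _ _ _] := nf.
have [x1L x2L y1L y2L x2Z] := xyL2.
have [|||||| e eZ ge] := @symplectic_completion x1 x2 (y1 ** y2) (- (x2 ** y5)) (x1 ** y2) y1 y2 y3 y4 y5.
- by [].
- by split; rewrite ?memvN; [apply: L2L2 | apply: x2Z | apply: L2L2].
- by [].
- by [].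
- rewrite !linearNl -!/(T x2 y5 _); split.
  + by rewrite triple_swapr /T m23 linear0l !oppr0.
  + by rewrite triple_swapr opprK.
  by rewrite triple23 oppr0.
- by split=> //; rewrite -/(T x1 y2 y3) triple_swapr; case: nf => [[_ _ [_ _ _ [_ _ m13]] _ _]];
    rewrite /T m13 linear0l oppr0.
have Te a b c := triple_modZ (eZ a) (eZ b) (eZ c).
exists (e \o code); split; first exact: gram_standard_basis.
- move=> u v w c /P10_entries[a' [b' [c' [-> -> -> -> abc']]]].
  rewrite -[LHS]/(T (e _) (e _) (e _)) Te.
  by move: abc'; rewrite !inE => /or3P[] /eqP[-> -> ->]; rewrite !decodeK.
move=> u v w nperm; rewrite -[LHS]/(T (e _) (e _) (e _)).
pose t a b c := T (e a) (e b) (e c).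
apply: (@alternating_sorted0 F t 10); rewrite ?code_lt //.
- by split=> *; [apply: triple_swap | apply: triple_cyc].
- by move=> a c; apply: triple12.
- by move=> a b c abc c10 nlisted; rewrite /t Te T0.
have nP (a b c : nat) : (decode a, decode b, decode c, 1) \in P10_3_4 F ->
    ~~ perm_eq [:: code u; code v; code w] [:: a; b; c].
  move=> /nperm; apply: contra => /(perm_map decode) /=.
  by rewrite !codeK.
by rewrite /listed !negb_or !nP //= !inE /idx_x /idx_y /decode /= eqxx ?orbT.
Qed.

End FromFrame.

(** * Existence of a frame *)

Section Nilpotent.

Variables (F : fieldType) (L : symplAltAlg F).
Implicit Types (x y z u v w : L) (A B C U V W : {vspace L}).

Lemma lcs_dec k : (saa_lcs L k.+2 <= saa_lcs L k.+1)%VS.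
Proof. by elim: k => [|k IHk]; [apply: subvf | apply: prodS]. Qed.

Lemma nilpotent_lcs : saa_nilpotent L -> exists k, saa_lcs L k.+1 = 0%VS.
Proof.
case=> [[|k] lcs0]; last by exists k.
by exists 0%N.
Qed.

(** Multiplying by a repeatedly pushes v into W + L^m for every m. *)
Lemma nilpotent_eigen W v a k : saa_nilpotent L -> (forall w, w \in W -> w ** a \in W) ->
  v ** a - k *: v \in W -> k != 0 -> v \in W.
Proof.
move=> /nilpotent_lcs[n lcs0] Wa vaW k0.
suff vWl m : v \in (W + saa_lcs L m.+1)%VS by have := vWl n; rewrite lcs0 addv0.
elim: m => [|m /memv_addP[w Ww [l lm v_wl]]]; first by rewrite addvf memvf.
rewrite -[v]scale1r -(mulVf k0) -scalerA; apply: memvZ.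
have -> : k *: v = (w ** a - (v ** a - k *: v)) + l ** a.
  by rewrite addrAC -linearDl -v_wl opprB addrC subrK.
apply: memv_add; last exact: mem_prod lm (memvf a).
by rewrite memvB ?Wa.
Qed.

Lemma ucsP k x : reflect (forall y, x ** y \in saa_ucs L k) (x \in saa_ucs L k.+1).
Proof.
apply: (iffP (saa_transpP _ _ _ _)) => [[_ xk] y|xk]; first by apply: xk; apply: memvf.
by split=> [|y _]; [apply: memvf | apply: xk].
Qed.

Lemma centerP x : reflect (forall y, x ** y = 0) (x \in saa_center L).
Proof. by apply: (iffP (ucsP 0 x)) => x0 y; [apply/eqP; rewrite -memv0; apply: x0 | rewrite x0 mem0v]. Qed.

Lemma dim_add_line W x : x \notin W -> \dim (W + <[x]>) = (\dim W).+1.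
Proof.
move=> Wx; rewrite dimv_disjoint_sum ?dim_vline.
  by have [x0|_] := eqVneq x 0; [rewrite x0 mem0v in Wx | rewrite addn1].
apply/eqP; rewrite -subv0; apply/subvP => y; rewrite memv_cap memv0 => /andP[Wy /vlineP[k y_kx]].
have [k0|k0] := eqVneq k 0; first by rewrite y_kx k0 scale0r.
by case/negP: Wx; rewrite -[x]scale1r -(mulVf k0) -scalerA -y_kx memvZ.
Qed.

Lemma add_line_eq W U x : (W <= U)%VS -> x \in U -> x \notin W -> (\dim U <= (\dim W).+1)%N ->
  (W + <[x]>)%VS = U.
Proof.
by move=> WU Ux Wx dU; apply/eqP; rewrite eqEdim subv_add WU -memvE Ux dim_add_line.
Qed.

End Nilpotent.

Section FrameExists.

Variables (F : fieldType) (L : symplAltAlg F).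
Implicit Types (x y z u v w p q r : L) (A B C U V W : {vspace L}).

Hypothesis nilL : saa_nilpotent L.
Hypothesis dimL : \dim {:L} = 10%N.
Hypothesis isoZ : saa_isotropic (saa_center L).
Hypothesis dimZ : \dim (saa_center L) = 3%N.
Hypothesis dimL3 : \dim (saa_lcs L 3) = 6%N.

Local Notation Z := (saa_center L).
Local Notation Z2 := (saa_ucs L 2).
Local Notation L2 := (saa_lcs L 2).
Local Notation L3 := (saa_lcs L 3).
Local Notation L4 := (saa_lcs L 4).
Local Notation L5 := (saa_lcs L 5).

Let perpL2 : saa_perp L2 = Z. Proof. by rewrite /saa_center ucs_perp. Qed.
Let perpZ : saa_perp Z = L2. Proof. by rewrite -perpL2 perpK. Qed.
Let perpL3 : saa_perp L3 = Z2. Proof. by rewrite ucs_perp. Qed.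
Let perpZ2 : saa_perp Z2 = L3. Proof. by rewrite -perpL3 perpK. Qed.

Let dimL2 : \dim L2 = 7%N.
Proof. by have := dim_perp Z; rewrite perpZ dimZ dimL; lia. Qed.
Let dimZ2 : \dim Z2 = 4%N.
Proof. by have := dim_perp L3; rewrite perpL3 dimL3 dimL; lia. Qed.

Lemma center_mul z u : z \in Z -> z ** u = 0.
Proof. by move/centerP. Qed.
Lemma center_orth z u : z \in Z -> u \in L2 -> '[z, u] = 0.
Proof. by rewrite -perpL2 => /saa_perpP; apply. Qed.
Lemma center_sub_lcs2 : (Z <= L2)%VS.
Proof. by rewrite -perpZ; apply/perpP2 => z z' Zz Zz'; apply: isoZ. Qed.

(** Otherwise Z supplies the dimension that L^3 lacks in L^2, and since Z
    annihilates L this gives L^3 = L^2 L = L^3 L, against nilpotence. *)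
Lemma center_sub_lcs3 : (Z <= L3)%VS.
Proof.
apply/negPn/negP => /subvPn[z Zz L3z].
have L2E : (L3 + <[z]>)%VS = L2.
  by apply: add_line_eq; rewrite ?lcs_dec ?(subvP center_sub_lcs2) ?dimL2 ?dimL3.
have L34 : (saa_prod L2 fullv <= L4)%VS.
  apply/saa_prod_subP => a b; rewrite -L2E => /memv_addP[l Ll [_ /vlineP[k ->] ->]] Lb.
  by rewrite linearDl /= linearZl_LR /= (center_mul _ Zz) scaler0 addr0 mem_prod.
have L3k k : (L3 <= saa_lcs L k.+3)%VS.
  elim: k => [|k IHk]; first exact: subvv.
  by apply: subv_trans L34 _; apply: prodS.
have [k lk0] := nilpotent_lcs nilL.
have : (L3 <= 0)%VS by rewrite -lk0 (subv_trans (L3k k)) // (subv_trans (lcs_dec _ _)) ?lcs_dec.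
by rewrite subv0 -dimv_eq0 dimL3.
Qed.

Lemma ucs2_sub_lcs2 : (Z2 <= L2)%VS.
Proof. by rewrite -perpZ sub_perpC perpZ2 center_sub_lcs3. Qed.

Lemma center_sub_ucs2 : (Z <= Z2)%VS.
Proof. by rewrite -perpL2 -perpL3 perpS ?lcs_dec. Qed.

(** Equivalently Z_2 is isotropic. It is Z plus one vector, and that vector lies
    in L^2, the annihilator of Z. *)
Lemma ucs2_sub_lcs3 : (Z2 <= L3)%VS.
Proof.
have /subvPn[x Z2x Zx] : ~~ (Z2 <= Z)%VS by apply/negP => /dimvS; rewrite dimZ2 dimZ.
have Z2E : (Z + <[x]>)%VS = Z2 by apply: add_line_eq; rewrite ?center_sub_ucs2 ?dimZ2 ?dimZ.
rewrite -perpZ2 -{1}Z2E; apply/perpP2 => _ b /memv_addP[z Zz [_ /vlineP[k ->] ->]].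
rewrite -Z2E => /memv_addP[z' Zz' [_ /vlineP[k' ->] ->]].
have xZ z0 : z0 \in Z -> '[z0, x] = 0 by move=> Zz0; apply: center_orth (subvP ucs2_sub_lcs2 _ Z2x).
rewrite !(linearDl, linearDr, linearZl_LR, linearZr_LR) /= saa_form_alt isoZ // xZ //.
by rewrite (saa_formC x) xZ // oppr0 !mulr0 !addr0.
Qed.

(** (x a, y) = - (x y, a), where x y is in Z, the annihilator of L^2. *)
Lemma ucs2_mul_lcs2 x a : x \in Z2 -> a \in L2 -> x ** a = 0.
Proof.
move=> /ucsP Zx L2a; apply: mul_eq0 => y; rewrite triple_swapr.
by rewrite /saa_triple (center_orth (Zx y) L2a) oppr0.
Qed.

Lemma ucs2_mul x y : x \in Z2 -> x ** y \in Z.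
Proof. by move/ucsP. Qed.

Let form_ucs2 x r : x \in Z2 -> r \in L3 -> '[x, r] = 0.
Proof. by rewrite -perpL3 => /saa_perpP; apply. Qed.

Lemma lcs3_split p q : p \in L3 -> q \in L3 -> '[p, q] = 1 ->
  (Z2 + <[p]> + <[q]>)%VS = L3.
Proof.
move=> L3p L3q pq.
have Z2p : p \notin Z2.
  by apply/negP => /form_ucs2/(_ L3q)/eqP; rewrite pq oner_eq0.
have Wq : q \notin (Z2 + <[p]>)%VS.
  apply/negP => /memv_addP[z Z2z [_ /vlineP[k ->] q_zp]].
  move/eqP: pq; rewrite q_zp linearDr linearZr_LR /= saa_form_alt saa_formC form_ucs2 //.
  by rewrite oppr0 mulr0 addr0 eq_sym oner_eq0.
apply: add_line_eq => //; last by rewrite dim_add_line // dimZ2 dimL3.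
by rewrite subv_add ucs2_sub_lcs3 -memvE.
Qed.

(** Right multiplication by y acts on the symplectic plane L^3 / Z_2, where
    (q y, q) = 0 makes q an eigenvector; by nilpotence the eigenvalue is 0. *)
Lemma lcs3_mul_orth p q : p \in L3 -> q \in L3 -> '[p, q] = 1 -> p ** q = 0.
Proof.
move=> L3p L3q pq; apply: mul_eq0 => y; rewrite triple_cyc /saa_triple.
have : q ** y \in L3 by apply: (subvP (lcs_dec L 2)); apply: mem_prod L3q (memvf y).
rewrite -(lcs3_split L3p L3q pq) => /memv_addP[_ /memv_addP[z Z2z [_ /vlineP[k ->] ->]]].
case=> _ /vlineP[l ->] qyE.
have k0 : k = 0.
  have := triple13 q y; rewrite /saa_triple qyE !linearDl !linearZl_LR /= saa_form_alt pq.
  by rewrite form_ucs2 // add0r mulr1 mulr0 addr0.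
rewrite qyE k0 scale0r addr0 linearDl linearZl_LR /= form_ucs2 // add0r.
have [->|l0] := eqVneq l 0; first by rewrite mul0r.
have Z2q : q \in Z2.
  apply: (@nilpotent_eigen _ _ _ q y l) => // [w Z2w|].
    by apply: (subvP center_sub_ucs2); apply: ucs2_mul.
  by rewrite qyE k0 scale0r addr0 addrK.
by have /eqP := form_ucs2 Z2q L3p; rewrite saa_formC pq oppr_eq0 oner_eq0.
Qed.

Lemma lcs3_mul_lcs3 r r' : r \in L3 -> r' \in L3 -> r ** r' = 0.
Proof.
have /subvPn[p L3p Z2p] : ~~ (L3 <= Z2)%VS by apply/negP => /dimvS; rewrite dimL3 dimZ2.
have [q L3q pq] : exists2 q, q \in L3 & '[p, q] = 1 by apply: notin_perp; rewrite perpL3.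
have m_pq := lcs3_mul_orth L3p L3q pq.
have m_qp : q ** p = 0 by rewrite saa_mulC m_pq oppr0.
have L32 := subvP (lcs_dec L 1).
have mZ2 z u : z \in Z2 -> u \in L3 -> z ** u = 0 by move=> Z2z /L32; apply: ucs2_mul_lcs2.
have mZ2' z u : z \in Z2 -> u \in L3 -> u ** z = 0 by move=> Z2z L3u; rewrite saa_mulC mZ2 ?oppr0.
have Z2L3 := subvP ucs2_sub_lcs3.
rewrite -(lcs3_split L3p L3q pq) => /memv_addP[_ /memv_addP[z Z2z [_ /vlineP[k ->] ->]]].
case=> _ /vlineP[l ->] -> /memv_addP[_ /memv_addP[z' Z2z' [_ /vlineP[k' ->] ->]]].
case=> _ /vlineP[l' ->] ->.
rewrite !(linearDl, linearDr, linearZl_LR, linearZr_LR) /= !saa_mul_alt m_pq m_qp.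
rewrite (mZ2 z z') ?(mZ2 z p) ?(mZ2 z q) ?(mZ2' z' p) ?(mZ2' z' q) //; last exact: Z2L3.
by rewrite !(scaler0, addr0).
Qed.

(** Z_2 is the annihilator of L^3, and L^3 L^3 = 0. *)
Lemma lcs4_sub_ucs2 : (L4 <= Z2)%VS.
Proof.
apply/saa_prod_subP => r y L3r _; rewrite -perpL3; apply/saa_perpP => r' L3r'.
by rewrite -/(saa_triple r y r') -triple_cyc /saa_triple lcs3_mul_lcs3 ?linear0l.
Qed.

Lemma lcs2_split y : y \in L2 -> y \notin L3 -> (L3 + <[y]>)%VS = L2.
Proof. by move=> L2y L3y; apply: add_line_eq; rewrite ?lcs_dec ?dimL2 ?dimL3. Qed.

(** The form (u v, w) vanishes on L^2 as soon as two arguments are in L^3, and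
    L^3 is a hyperplane of L^2. *)
Lemma lcs2_mul_lcs2 u v : u \in L2 -> v \in L2 -> u ** v \in Z.
Proof.
have /subvPn[y L2y L3y] : ~~ (L2 <= L3)%VS by apply/negP => /dimvS; rewrite dimL2 dimL3.
have L2E := lcs2_split L2y L3y.
rewrite -perpL2 -{1 2}L2E => /memv_addP[r L3r [_ /vlineP[k ->] ->]].
case/memv_addP=> r' L3r' [_ /vlineP[k' ->] ->]; apply/saa_perpP => w.
rewrite -L2E => /memv_addP[r'' L3r'' [_ /vlineP[k'' ->] ->]].
rewrite -/(saa_triple _ _ _) !(tripleDl, tripleDm, tripleDr, tripleZl, tripleZm, tripleZr).
rewrite !(triple12, triple23, triple13) (triple_swapr r y) (triple_cyc y).
by rewrite /saa_triple !lcs3_mul_lcs3 // !linear0l oppr0 !(mulr0, addr0).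
Qed.

(** Such an r annihilates L^2, so (r z, a) = - (r a, z) = 0 for a in L^2. *)
Lemma lcs3_mul_eq0 r y : r \in L3 -> y \in L2 -> y \notin L3 -> r ** y = 0 -> r \in Z2.
Proof.
move=> L3r L2y L3y ry0; apply/ucsP => z; rewrite -[saa_ucs L 1]/Z -perpL2; apply/saa_perpP => a.
rewrite -(lcs2_split L2y L3y) -/(saa_triple r z a) triple_swapr.
move=> /memv_addP[r' L3r' [_ /vlineP[k ->] ->]].
by rewrite /saa_triple linearDr linearZr_LR /= ry0 scaler0 addr0 lcs3_mul_lcs3 // linear0l oppr0.
Qed.

(** L^4 <= Z would mean L^3 <= Z_2. *)
Lemma lcs4_nsub_center : exists2 x, x \in L4 & x \notin Z.
Proof.
apply/subvPn/negP => L4Z; have : (L3 <= Z2)%VS.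
  apply/subvP => r L3r; apply/ucsP => y; apply: (subvP L4Z).
  exact: mem_prod L3r (memvf y).
by move/dimvS; rewrite dimL3 dimZ2.
Qed.

(** L^4 is contained in Z_2 = Z + <x>, and Z annihilates L. *)
Lemma lcs5P x v : x \in L4 -> x \notin Z -> reflect (exists y, v = x ** y) (v \in L5).
Proof.
move=> L4x Zx; have Z2E : (Z + <[x]>)%VS = Z2.
  by apply: add_line_eq; rewrite ?center_sub_ucs2 ?(subvP lcs4_sub_ucs2) ?dimZ2 ?dimZ.
apply: (iffP idP) => [L5v|[y ->]]; last exact: mem_prod L4x (memvf y).
have /subvP/(_ v L5v)/memv_imgP[y _ ->] : (saa_prod L4 fullv <= limg (linfun (saa_mul L x)))%VS.
  apply/saa_prod_subP => u y /(subvP lcs4_sub_ucs2); rewrite -Z2E.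
  move=> /memv_addP[z Zz [_ /vlineP[k ->] ->]] _.
  rewrite linearDl linearZl_LR /= (center_mul _ Zz) add0r; apply: memvZ.
  by rewrite -[x ** y](lfunE (saa_mul L x)) memv_img ?memvf.
by exists y; rewrite lfunE.
Qed.

Lemma notin_center x : x \notin Z -> exists a b, T x a b = 1.
Proof.
move=> Zx; pose f := linfun (saa_mul L x); have /memv_imgP[a _ fa] := memv_pick (limg f).
have [|b xab] := @saa_form_ex _ _ (x ** a); last by exists a, b.
rewrite -[x ** a](lfunE (saa_mul L x)) -fa vpick0; apply: contraNneq Zx => f0.
by apply/centerP => y; apply/eqP; rewrite -memv0 -f0 -[x ** y](lfunE (saa_mul L x)) memv_img ?memvf.
Qed.

(** The alternating form (x u, v) on the space L / L^2, of dimension 3, is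
    degenerate. With (x a, b) = 1, any third vector corrected to be orthogonal to
    a and b spans its radical. *)
Lemma ucs2_annihilator x : x \in Z2 -> x \notin Z -> exists2 y, y \notin L2 & x ** y = 0.
Proof.
move=> Z2x Zx; have L2x0 a : a \in L2 -> x ** a = 0 by apply: ucs2_mul_lcs2.
have ZL x' l : l \in L2 -> '[x ** x', l] = 0 by apply: center_orth; apply: ucs2_mul.
have [a [b xab]] := notin_center Zx.
have L2a : a \notin L2.
  by apply: contra_eqN xab => /L2x0; rewrite /saa_triple => ->; rewrite linear0l eq_sym oner_eq0.
have Wb : b \notin (L2 + <[a]>)%VS.
  apply/negP => /memv_addP[l L2l [_ /vlineP[k ->] bE]]; move/eqP: xab.
  by rewrite bE tripleDr tripleZr triple23 mulr0 addr0 /saa_triple ZL // eq_sym oner_eq0.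
have dimW : \dim (L2 + <[a]> + <[b]>) = 9%N by rewrite !dim_add_line ?dimL2.
have /subvPn[c _ Wc] : ~~ (fullv <= L2 + <[a]> + <[b]>)%VS.
  by apply/negP => /dimvS; rewrite dimL dimW.
have fullE : (L2 + <[a]> + <[b]> + <[c]>)%VS = fullv.
  by apply: add_line_eq; rewrite ?subvf ?memvf ?dimW ?dimL.
pose y := c - T x c b *: a + T x c a *: b.
have xba : T x b a = -1 by rewrite triple_swapr xab.
have xyb : T x y b = 0.
  by rewrite /y -scaleNr !(tripleDm, tripleZm) triple23 xab; ring.
have xya : T x y a = 0.
  by rewrite /y -scaleNr !(tripleDm, tripleZm) triple23 xba; ring.
have cE : c = y + T x c b *: a - T x c a *: b.
  by rewrite /y addrAC addrK subrK.
clearbody y; exists y.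
  apply: contra Wc => L2y; rewrite cE -scaleNr.
  by rewrite memv_add ?memvZ ?memv_line // memv_add ?memvZ ?memv_line.
apply: mul_eq0 => z; have := memvf z; rewrite -fullE.
case/memv_addP=> _ /memv_addP[_ /memv_addP[l L2l [_ /vlineP[k1 ->] ->]] [_ /vlineP[k2 ->] ->]].
case=> _ /vlineP[k3 ->] ->; rewrite [in k3 *: c]cE -scaleNr.
rewrite !(tripleDr, tripleZr) triple23 xya xyb [T x y l]ZL //; ring.
Qed.

(** L^5 = x L is orthogonal to L^2 and to y, so it is contained in a plane.
    It has dimension at least 2: if (x a, b) = 1 then x a and x b are
    independent because (x a, a) = 0. *)
Lemma lcs5_perp x y : x \in L4 -> x \notin Z -> y \notin L2 -> x ** y = 0 ->
  L5 = saa_perp (L2 + <[y]>)%VS.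
Proof.
move=> L4x Zx L2y xy; have Z2x := subvP lcs4_sub_ucs2 _ L4x; have inL5 := lcs5P _ L4x Zx.
apply/eqP; rewrite eqEdim; apply/andP; split.
  apply/perpP2 => v _ /inL5[u ->] /memv_addP[l L2l [_ /vlineP[k ->] ->]].
  rewrite linearDr linearZr_LR /= (center_orth (ucs2_mul u Z2x) L2l) add0r.
  by rewrite -/(saa_triple x u y) triple_swapr /saa_triple xy linear0l oppr0 mulr0.
have := dim_perp (L2 + <[y]>); rewrite dim_add_line // dimL2 dimL => dimP.
suff : (2 <= \dim L5)%N by move: dimP; lia.
have [a [b xab]] := notin_center Zx.
have xb_nxa : x ** b \notin <[x ** a]>%VS.
  apply/negP => /vlineP[k xbE]; have : T x b a = k * T x a a.
    by rewrite /saa_triple xbE linearZl_LR.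
  by move/eqP; rewrite triple_swapr xab triple23 mulr0 oppr_eq0 oner_eq0.
have xa_n0 : x ** a \notin 0%VS.
  apply: contra_eqN xab; rewrite memv0 /saa_triple => /eqP ->.
  by rewrite linear0l eq_sym oner_eq0.
have dim2 : \dim (0 + <[x ** a]> + <[x ** b]>) = 2%N.
  by rewrite dim_add_line ?add0v // -[<[_]>%VS]add0v dim_add_line ?dimv0.
suff /dimvS : (0 + <[x ** a]> + <[x ** b]> <= L5)%VS by rewrite dim2.
rewrite add0v subv_add -!memvE; apply/andP.
by split; apply/inL5; eexists.
Qed.

(** Since L^3 L^3 = 0 only multiplication by y matters, and its kernel on L^3 is
    Z_2. *)
Lemma prod_lcs32 y : y \in L2 -> y \notin L3 ->
  saa_prod L3 L2 = (linfun (applyr (saa_mul L) y) @: L3)%VS /\ \dim (saa_prod L3 L2) = 2%N.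
Proof.
move=> L2y L3y; set g := linfun _.
have gE r : g r = r ** y by rewrite lfunE.
have imE : saa_prod L3 L2 = (g @: L3)%VS.
  apply/eqP; rewrite eqEsubv; apply/andP; split.
    apply/saa_prod_subP => r a L3r; rewrite -(lcs2_split L2y L3y).
    case/memv_addP=> r' L3r' [_ /vlineP[k ->] ->].
    by rewrite linearDr linearZr_LR /= lcs3_mul_lcs3 // add0r memvZ // -gE memv_img.
  by apply/subvP => _ /memv_imgP[r L3r ->]; rewrite gE mem_prod.
split=> //; have := limg_ker_dim g L3; rewrite -imE dimL3.
suff -> : (L3 :&: lker g)%VS = Z2 by rewrite dimZ2; lia.
apply/vspaceP => r; rewrite memv_cap memv_ker gE; apply/andP/idP => [[L3r /eqP]|Z2r].
  exact: lcs3_mul_eq0.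
by rewrite (subvP ucs2_sub_lcs3) // ucs2_mul_lcs2.
Qed.

Section Frame.

Hypothesis L32_neq_L5 : saa_prod L3 L2 <> L5.
Hypothesis dimUZ4 : \dim (saa_prod (saa_U L) (saa_ucs L 4)) = 1%N.

(** The planes L^5 and L^3 L^2 of the centre meet in the line of
    x1 y2 = x2 y4. The vector y1 is chosen with y1 y2 outside L^5, and y3 with
    x2 y3 = 0, so that L^5 is the annihilator of y3 in Z. *)
Lemma frame_exists : exists x1 x2 y1 y2 y3 y4 y5, frame Z L2 x1 x2 y1 y2 y3 y4 y5.
Proof.
have L32 := subvP (lcs_dec L 1); have Z2L3 := subvP ucs2_sub_lcs3.
have [x2 L4x2 Zx2] := lcs4_nsub_center.
have Z2x2 : x2 \in Z2 by apply: (subvP lcs4_sub_ucs2).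
have inL5 := lcs5P _ L4x2 Zx2.
have [y2a L2y2a x2y2a] : exists2 y, y \in L2 & '[x2, y] = 1.
  by apply: notin_perp; rewrite perpL2.
have L3y2a : y2a \notin L3.
  by apply/negP => /(form_ucs2 Z2x2)/eqP; rewrite x2y2a oner_eq0.
have [y3a L2y3a x2y3a] := ucs2_annihilator Z2x2 Zx2.
have L5E := lcs5_perp L4x2 Zx2 L2y3a x2y3a.
have inL5' z : z \in Z -> T x2 y3a z = 0 -> '[z, y3a] = 0 -> z \in L5.
  move=> Zz _ zy; rewrite L5E; apply/saa_perpP => _ /memv_addP[l L2l [_ /vlineP[k ->] ->]].
  by rewrite linearDr linearZr_LR /= zy mulr0 addr0 center_orth.
(* Both planes have dimension 2, so L^3 L^2 is not contained in L^5. *)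
have [y1 L3y1 y123a] : exists2 y1, y1 \in L3 & T y1 y2a y3a = 1.
  have [imE dim2] := prod_lcs32 L2y2a L3y2a.
  have /subvPn[_ /memv_imgP[p L3p ->]] : ~~ (linfun (applyr (saa_mul L) y2a) @: L3 <= L5)%VS.
    apply/negP; rewrite -imE => L32_L5; apply: L32_neq_L5; apply/eqP; rewrite eqEdim L32_L5 dim2.
    have := dim_perp (L2 + <[y3a]>); rewrite dim_add_line // dimL2 dimL -L5E.
    by move: (\dim L5) => d; lia.
  rewrite lfunE /= => pL5.
  have Zp : p ** y2a \in Z by apply: lcs2_mul_lcs2 => //; apply: L32.
  have py3 : T p y2a y3a != 0.
    by apply: contra pL5 => /eqP py3; apply: inL5' => //; rewrite /saa_triple x2y3a linear0l.
  by exists ((T p y2a y3a)^-1 *: p); rewrite ?memvZ // tripleZl mulVf.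
have Z2y1 : y1 \notin Z2.
  apply: contra_eqN y123a => Z2y1.
  by rewrite /saa_triple ucs2_mul_lcs2 // linear0l eq_sym oner_eq0.
have [p L3p y1p] : exists2 p, p \in L3 & '[y1, p] = 1 by apply: notin_perp; rewrite perpL3.
pose x1 := - p + T p y2a y3a *: y1.
have L3x1 : x1 \in L3 by rewrite memvD ?memvN ?memvZ.
have x1y1 : '[x1, y1] = 1.
  by rewrite linearDl linearNl linearZl_LR /= saa_form_alt saa_formC y1p opprK mulr0 addr0.
have x123a : T x1 y2a y3a = 0.
  by rewrite /x1 -scaleN1r !(tripleDl, tripleZl) y123a; ring.
clearbody x1.
have Z2x1 : x1 \notin Z2.
  by apply: contra_eqN x1y1 => Z2x1; rewrite (form_ucs2 Z2x1) // eq_sym oner_eq0.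
(* Moving y2a by L^3 changes no product with L^3, as L^3 L^3 = 0. *)
pose y2 := y2a + ('[y1, y2a] *: x1 - '[x1, y2a] *: y1).
have L3d : '[y1, y2a] *: x1 - '[x1, y2a] *: y1 \in L3 by rewrite memvB ?memvZ.
have L2y2 : y2 \in L2 by apply: memvD => //; apply: L32.
have mul_y2 r : r \in L3 -> r ** y2 = r ** y2a.
  by move=> L3r; rewrite linearDr /= (lcs3_mul_lcs3 L3r L3d) addr0.
have x2y2 : '[x2, y2] = 1 by rewrite linearDr /= (form_ucs2 Z2x2 L3d) addr0.
have x1y2 : '[x1, y2] = 0.
  rewrite /y2 -scaleNr !(linearDr, linearZr_LR) /= saa_form_alt x1y1; ring.
have y1y2 : '[y1, y2] = 0.
  rewrite /y2 -scaleNr !(linearDr, linearZr_LR) /= saa_form_alt (saa_formC y1 x1) x1y1; ring.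
have L3y2 : y2 \notin L3.
  by apply: contra_eqN x2y2 => /(form_ucs2 Z2x2) ->; rewrite eq_sym oner_eq0.
have y123 : T y1 y2 y3a = 1 by rewrite /saa_triple mul_y2.
have x123 : T x1 y2 y3a = 0 by rewrite /saa_triple mul_y2.
have m22 : x2 ** y2 = 0 by apply: ucs2_mul_lcs2.
clearbody y2; clear mul_y2 y123a x123a L3d.
have Zx1y2 : x1 ** y2 \in Z by apply: lcs2_mul_lcs2 => //; apply: L32.
have x1y2_n0 : x1 ** y2 != 0.
  by apply: contra Z2x1 => /eqP; apply: lcs3_mul_eq0.
have L5x1y2 : x1 ** y2 \in L5 by apply: inL5' => //; rewrite /saa_triple x2y3a linear0l.
have [y4a x1y2E] := inL5 _ L5x1y2.
have [y5a x125a] := saa_form_ex x1y2_n0; rewrite -/(saa_triple _ _ _) in x125a.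
(* x1 is in U, and both y2 and y3a are in Z_4, so U Z_4 is the line of x1 y2. *)
have [k x1y3a] : exists k, x1 ** y3a = k *: (x1 ** y2).
  have Ux1 : x1 \in saa_U L.
    apply/saa_transpP; split=> // b; rewrite -{1}(lcs2_split L2y2 L3y2).
    case/memv_addP=> r L3r [_ /vlineP[l ->] ->].
    rewrite linearDr linearZr_LR /= lcs3_mul_lcs3 // add0r; apply: memvZ.
    by rewrite memv_cap L5x1y2 (mem_prod L3x1 L2y2).
  have Z4E : saa_ucs L 4 = (L2 + <[y3a]>)%VS by rewrite ucs_perp L5E perpK.
  have UZ : saa_prod (saa_U L) (saa_ucs L 4) = <[x1 ** y2]>%VS.
    apply/eqP; rewrite eq_sym eqEdim dimUZ4 dim_vline x1y2_n0 andbT -memvE mem_prod // Z4E.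
    exact: (subvP (addvSl _ _)).
  apply/vlineP; rewrite -UZ; apply: mem_prod => //.
  by rewrite Z4E; apply: (subvP (addvSr _ _)); apply: memv_line.
pose y3 := y3a - k *: y2.
have m23 : x2 ** y3 = 0 by rewrite linearBr linearZr_LR /= x2y3a m22 scaler0 subr0.
have m13 : x1 ** y3 = 0 by rewrite linearBr linearZr_LR /= x1y3a subrr.
have T123 : T y1 y2 y3 = 1.
  by rewrite /y3 -scaleNr tripleDr tripleZr triple23 mulr0 addr0.
clearbody y3.
pose y4 := y4a - T y1 y2 y4a *: y3; pose y5 := y5a - T y1 y2 y5a *: y3.
have x2y4 : x2 ** y4 = x1 ** y2 by rewrite linearBr linearZr_LR /= m23 scaler0 subr0.
have x12y3 : T x1 y2 y3 = 0 by rewrite triple_swapr /saa_triple m13 linear0l oppr0.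
exists x1, x2, y1, y2, y3, y4, y5; split.
- split=> //; [exact: L32 | exact/L32/Z2L3 | exact: L32 | by move=> u; apply: ucs2_mul].
- do 2![split=> //]; first by rewrite saa_formC form_ucs2 ?oppr0.
  exact: form_ucs2.
- by have L3x2 := Z2L3 _ Z2x2; do 3?[split; try exact: lcs3_mul_lcs3].
- split=> //; first by rewrite /y5 -scaleNr tripleDr tripleZr x12y3 mulr0 addr0.
  by rewrite /saa_triple x2y4 /y5 linearBr linearZr_LR /= -!/(saa_triple _ _ _) x12y3 mulr0 subr0.
- split.
  + by rewrite /saa_triple -x2y4 -/(saa_triple _ _ _) triple23.
  + by rewrite /y4 -scaleNr tripleDr tripleZr T123; ring.
  by rewrite /y5 -scaleNr tripleDr tripleZr T123; ring.
Qed.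

End Frame.

End FrameExists.

(** * The classification *)

Lemma conditions_presentation (F : fieldType) (M : symplAltAlg F) :
  P10_3_4_conditions M -> satisfies_presentation M (P10_3_4 F).
Proof.
case=> [[nilM dimM] [isoZ dimZ] dimL3 L32 dimUZ4].
have [x1 [x2 [y1 [y2 [y3 [y4 [y5 fr]]]]]]] :=
  frame_exists nilM dimM isoZ dimZ dimL3 L32 dimUZ4.
have [x1' [y1' [y2' [y3' [y4' [y5' nfr]]]]]] := normalize_frame fr.
apply: (normal_frame_presentation dimM _ _ _ _ nfr).
- exact: center_mul.
- exact: center_orth.
- exact: center_sub_lcs2.
- exact: (lcs2_mul_lcs2 nilM dimM isoZ dimZ dimL3).
Qed.

Lemma P10_exists (F : fieldType) : exists L : symplAltAlg F, satisfies_presentation L (P10_3_4 F).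
Proof.
have entry p : p \in P10_3_4 F -> exists a b c,
    p = (decode a, decode b, decode c, 1) /\ (a, b, c) \in [:: (0, 6, 9); (5, 6, 7); (1, 8, 9)]%N.
  case: p => [[[u v] w] d] /P10_entries[a [b [c [-> -> -> -> abc]]]]; exists a, b, c; split=> //.
  by move: abc; rewrite !inE => /or3P[] /eqP[-> -> ->].
have decodeKs s : all (fun k => k < 10)%N s -> map code (map decode s) = s.
  by move=> /allP s10; rewrite -map_comp map_id_in // => k /s10/decodeK.
have perm_decode s t : all (fun k => k < 10)%N s -> all (fun k => k < 10)%N t ->
    perm_eq (map decode s) (map decode t) -> perm_eq s t.
  by move=> /decodeKs {2}<- /decodeKs {2}<-; apply: perm_map.
exists (pres_alg (P10_3_4 F)); apply: pres_alg_presentation.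
- by apply: (@map_uniq _ _ (fun p => code p.1.1.1)); rewrite /= !inordK.
- move=> _ /entry[a [b [c [-> abc]]]].
  have : uniq (map code (map decode [:: a; b; c])).
    by move: abc; rewrite !inE => /or3P[] /eqP[-> -> ->]; rewrite decodeKs.
  exact: map_uniq.
move=> _ _ /entry[a [b [c [-> abc]]]] /entry[a' [b' [c' [-> abc']]]] /=.
move/(@perm_decode [:: a; b; c] [:: a'; b'; c']).
by move: abc abc'; rewrite !inE => /or3P[] /eqP[-> -> ->] /or3P[] /eqP[-> -> ->] // /(_ isT isT).
Qed.

Theorem proposition4p8 (F : fieldType) :
  exists L : symplAltAlg F,
    [/\ P10_3_4_conditions L,
        forall M : symplAltAlg F, P10_3_4_conditions M -> saa_isom L M
      & satisfies_presentation L (P10_3_4 F)].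
Proof.
have [L presL] := P10_exists F; exists L; split=> //.
  by have [e [se e1 e0]] := presL; apply: presented_conditions e1 e0.
by move=> M /conditions_presentation; apply: presentation_isom.
Qed.
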